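(* Assume: (i) $Y := c_T(X_T)+\sum_{t=0}^{T-1}c_t(X_t,U_t)$, where $c_t:S\times A\to\mathbb{R}$ ($t=0,\dots,T-1$) and $c_T:S\to\mathbb{R}$ are bounded and upper semicontinuous; (ii) the transition kernel $Q$ is continuous in total variation, i.e., $(x_n,u_n)\to(x,u)$ implies $|Q(\cdot\mid x_n,u_n)-Q(\cdot\mid x,u)|(S)\to 0$. Let $\alpha\in(0,1]$. Define $J^\alpha_T:=c_T$ and, for $t=T-1,\dots,0$, $$\varphi^\alpha_t(x,u):=\sup_{\xi\in\mathcal{R}_\alpha(x,u)}\int_S J^\alpha_{t+1}\,\xi\,\mathrm{d}Q(\cdot\mid x,u),\quad v^\alpha_t:=c_t+\varphi^\alpha_t,\quad J^\alpha_t(x):=\inf_{u\in A}v^\alpha_t(x,u)\ \ (x\in S).$$ Then $J^\alpha_t$ is upper semicontinuous and bounded for all $t=0,1,\dots,T$. For every $\epsilon>0$ there is a deterministic Markov policy $\pi^*_\epsilon\in\Pi$ such that $\rho^{\pi^*_\epsilon}_{\alpha,x}(Y)\le J^\alpha_0(x)+\epsilon$ for all $x\in S$. In particular, $\inf_{\pi\in\Pi}\rho^\pi_{\alpha,x}(Y)\le J^\alpha_0(x)$ for all $x\in S$.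
   Context: Setting: $S$, $A$, $W$ are Borel spaces, $T\in\mathbb{N}$, $\Omega=(S\times A)^T\times S$ with Borel $\sigma$-algebra $\mathcal{B}(\Omega)$; $\omega=(x_0,u_0,\dots,x_{T-1},u_{T-1},x_T)$, $X_t(\omega)=x_t$, $U_t(\omega)=u_t$. $f:S\times A\times W\to S$ is Borel measurable, $P_D$ a distribution on $W$, and $Q(B\mid x,u)=P_D(\{d\in W: f(x,u,d)\in B\})$. $\Pi$ is the set of randomized history-dependent policies (Borel stochastic kernels $\pi_t$ on $A$ given $(S\times A)^t\times S$, $t=0,\dots,T-1$), which includes deterministic Markov policies; $P_x^\pi$ is the induced probability measure on $\Omega$ with $X_0=x$, $U_t\sim\pi_t(\cdot\mid\text{history})$, $X_{t+1}\sim Q(\cdot\mid X_t,U_t)$. For $(x,u)\in S\times A$, $\mathcal{R}_\alpha(x,u)$ is the set of Borel-measurable $\nu:S\to\mathbb{R}$ with $0\le\nu\le\alpha^{-1/T}$ $Q(\cdot\mid x,u)$-a.e. and $\int_S\nu\,\mathrm{d}Q(\cdot\mid x,u)=1$. $\mathcal{D}_\alpha$ is the set of tuples $(\xi_0,\dots,\xi_{T-1})$ where each $\xi_t(\cdot\mid\cdot,\cdot):S\times S\times A\to\mathbb{R}$ is Borel measurable and $\xi_t(\cdot\mid x,u)\in\mathcal{R}_\alpha(x,u)$ for every $(x,u)\in S\times A$. For $Y\in L^\infty(\Omega,\mathcal{B}(\Omega),P_x^\pi)$, $$\rho^\pi_{\alpha,x}(Y):=\sup_{(\xi_0,\dots,\xi_{T-1})\in\mathcal{D}_\alpha}\int_\Omega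 Y(\omega)\prod_{t=0}^{T-1}\xi_t(x_{t+1}\mid x_t,u_t)\,\mathrm{d}P_x^\pi(\omega).$$ *)

(* Defs.v *)
From HB Require Import structures.
From mathcomp Require Import all_boot all_order all_algebra.
From mathcomp Require Import all_classical all_reals all_analysis.
From mathcomp Require Import measurable_realfun.

Set Implicit Arguments.
Unset Strict Implicit.
Unset Printing Implicit Defensive.

Import Order.TTheory GRing.Theory Num.Theory.

Local Open Scope classical_set_scope.
Local Open Scope ring_scope.

Definition borel (T : ptopologicalType) := g_sigma_algebraType (@open T).

Definition borel_space (R : realType) (X : topologicalType) : Prop :=
  exists (P : completePseudoMetricType R) (B : set P) (e : X -> P),
    [/\ hausdorff_space P, (exists2 D : set P, countable D & dense D),
        <<s @open P >> B, range e = B &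
        [/\ injective e, continuous e &
            forall U : set X, open U ->
              exists2 V : set P, open V & e @` U = V `&` B]].

Definition usc (X : topologicalType) (R : realType) (g : X -> R) : Prop :=
  forall x (a : R), g x < a ->
    exists2 V, nbhs x V & forall y, V y -> g y < a.

Definition usc_e (X : topologicalType) (R : realType) (g : X -> \bar R)
  : Prop :=
  forall x (a : R), (g x < a%:E)%E ->
    exists2 V, nbhs x V & forall y, V y -> (g y < a%:E)%E.

Definition bounded_rfun (X : Type) (R : realType) (g : X -> R) : Prop :=
  exists M : R, forall x, `|g x| <= M.

Definition bounded_efun (X : Type) (R : realType) (g : X -> \bar R) : Prop :=
  exists M : R, forall x, (`|g x| <= M%:E)%E.

Section MDP.
Variables (R : realType) (T : nat) (S A W : ptopologicalType).
Variables (f : S -> A -> W -> S) (PD : probability (borel W) R).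

Definition Qk (x : S) (u : A) : set (borel S) -> \bar R :=
  fun B => PD ((f x u) @^-1` B).

Definition tv_dist (mu nu : set (borel S) -> \bar R) : \bar R :=
  ereal_sup [set r | exists (n : nat) (E : nat -> set (borel S)),
     [/\ forall i, (i < n)%N -> measurable (E i),
         forall i j, (i < n)%N -> (j < n)%N -> i <> j -> E i `&` E j = set0,
         \bigcup_(i in [set i | (i < n)%N]) E i = setT &
         r = (\sum_(i < n) `|mu (E i) - nu (E i)|)%E]].

Definition Ralpha (alpha : R) (x : S) (u : A) (nu : S -> R) : Prop :=
  [/\ measurable_fun setT (nu : borel S -> R),
      exists2 N : set (borel S), measurable N /\ Qk x u N = 0%E &
        ~` [set y | 0 <= nu y <= powR alpha (- (T%:R^-1))] `<=` N &
      (\int[Qk x u]_y (nu y)%:E = 1)%E].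

(* D_alpha : tuples (xi_0, ..., xi_{T-1}); xi t y x u stands for xi_t(y|x,u) *)
Definition Dalpha (alpha : R) : set (nat -> S -> S -> A -> R) :=
  [set xi | forall t, (t < T)%N ->
     measurable_fun setT
       (fun p : (borel S * borel S * borel A)%type => xi t p.1.1 p.1.2 p.2)
     /\ forall x u, Ralpha alpha x u (fun y => xi t y x u)].

(* Sample space Omega = (S x A)^T x S, represented by trajectories
   w = (xs, us); only x_0..x_T and u_0..u_{T-1} are relevant: the
   sigma-algebra is generated by these coordinate maps. *)
Definition traj := ((nat -> S) * (nat -> A))%type.

Definition omega_gen : set (set traj) :=
  [set E | exists t (B : set (borel S)),
      [/\ (t <= T)%N, measurable B & E = (fun w : traj => w.1 t) @^-1` B]]
  `|`
  [set E | exists t (B : set (borel A)),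
      [/\ (t < T)%N, measurable B & E = (fun w : traj => w.2 t) @^-1` B]].

Definition Omega := g_sigma_algebraType omega_gen.

(* A (randomized, history-dependent) policy: pi t w = pi_t(. | x_0,u_0,...,x_t).
   pi t is required to be a Borel kernel which depends on w only through
   the history (x_0,u_0,...,u_{t-1},x_t). *)
Definition policy := nat -> traj -> probability (borel A) R.

Definition is_policy (pi : policy) : Prop :=
  forall t, (t < T)%N ->
    (forall B : set (borel A), measurable B ->
       measurable_fun [set: Omega] (fun w : Omega => (pi t w B : \bar R))) /\
    (forall w w' : traj,
       (forall s, (s <= t)%N -> w.1 s = w'.1 s) ->
       (forall s, (s < t)%N -> w.2 s = w'.2 s) -> pi t w = pi t w').

Definition markov_policy (g : nat -> S -> A) : policy :=
  fun t w => (\d_(g t (w.1 t) : borel A) : probability (borel A) R).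

Definition upd (w : traj) (t : nat) (u : A) (y : S) : traj :=
  (fun s => if s == t.+1 then y else w.1 s,
   fun s => if s == t then u else w.2 s).

Fixpoint iter_int (pi : policy) (k : nat) (g : traj -> \bar R) (w : traj)
  : \bar R :=
  match k with
  | 0 => g w
  | k'.+1 =>
      let t := (T - k)%N in
      (\int[pi t w]_u
         \int[Qk (w.1 t) u]_y iter_int pi k' g (upd w t u y))%E
  end.

Definition init_traj (x : S) : traj := (fun _ => x, fun _ => point).

Definition pathP (x : S) (pi : policy) : set Omega -> \bar R :=
  fun E => iter_int pi T (fun w => (\1_E w)%:E) (init_traj x).

Definition rho (alpha : R) (pi : policy) (x : S) (Y : traj -> R) : \bar R :=
  ereal_sup [set (\int[pathP x pi]_w
                   (Y w * \prod_(t < T) xi t (w.1 t.+1) (w.1 t) (w.2 t))%:E)%E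
            | xi in Dalpha alpha].

Definition total_cost (c : nat -> S -> A -> R) (cT : S -> R) (w : traj) : R :=
  cT (w.1 T) + \sum_(t < T) c t (w.1 t) (w.2 t).

Definition phi_op (alpha : R) (Jn : S -> \bar R) (x : S) (u : A) : \bar R :=
  ereal_sup [set (\int[Qk x u]_y (Jn y * (nu y)%:E))%E
            | nu in Ralpha alpha x u].

(* Jrec k = J_{T-k} *)
Fixpoint Jrec (alpha : R) (c : nat -> S -> A -> R) (cT : S -> R) (k : nat)
  : S -> \bar R :=
  match k with
  | 0 => fun x => (cT x)%:E
  | k'.+1 => fun x =>
      let t := (T - k)%N in
      ereal_inf (range (fun u : A =>
        ((c t x u)%:E + phi_op alpha (Jrec alpha c cT k') x u)%E))
  end.

Definition J (alpha : R) (c : nat -> S -> A -> R) (cT : S -> R) (t : nat)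
  : S -> \bar R := Jrec alpha c cT (T - t).

End MDP.

(* Main.v *)
Require Import Defs.
From HB Require Import structures.
From mathcomp Require Import all_boot all_order all_algebra.
From mathcomp Require Import all_classical all_reals all_analysis.
From mathcomp Require Import measurable_realfun.
From mathcomp Require Import ring lra.
Set Implicit Arguments.
Unset Strict Implicit.
Unset Printing Implicit Defensive.
Import Order.TTheory GRing.Theory Num.Theory.
Import numFieldNormedType.Exports.
Local Open Scope classical_set_scope.
Local Open Scope ring_scope.

(** Borel spaces are second countable, so semicontinuity can be tested along
    sequences and upper semicontinuous functions on S * A are measurable for
    the product of the Borel sigma-algebras. If two transition probabilities
    differ by at most d on every event, a density in [0, M] for the first can
    be corrected, by scaling it down or by mixing it with the constant M, into
    a density in [0, M] for the second, at an L^1 cost of order d; hence the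
    one-step risk operator maps bounded measurable functions to upper
    semicontinuous ones. An infimum over actions of an upper semicontinuous
    function is upper semicontinuous and is attained up to eps along a dense
    sequence of actions, and choosing the first good index is measurable.
    Backward induction along the trajectories then bounds the risk of the
    resulting Markov policy: at each stage the density xi_t is one competitor
    in the supremum that defines the risk operator. *)

(** * Countable bases and upper semicontinuity *)

Definition is_base (X : topologicalType) (U : nat -> set X) : Prop :=
  (forall n, open (U n)) /\
  forall x V, nbhs x V -> exists n, U n x /\ U n `<=` V.

Lemma is_base_countType (X : topologicalType) (I : countType)
    (U : I -> set X) :
  (forall i, open (U i)) ->
  (forall x V, nbhs x V -> exists i, U i x /\ U i `<=` V) ->
  exists V : nat -> set X, is_base V.
Proof.
move=> oU bU; exists (fun n => if unpickle n is Some i then U i else set0).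
split=> [n|x V /bU[i [Uix UiV]]].
  by case: unpickle => [i|]; [exact: oU | exact: open0].
by exists (pickle i); rewrite pickleK.
Qed.

(** Interiors of balls of radius [1/(m+1)] around the points of a countable dense set of [P], pulled
    back along the embedding [e], form a base. *)
Lemma borel_space_base (R : realType) (X : topologicalType) :
  borel_space R X -> exists U : nat -> set X, is_base U.
Proof.
move=> [P [B [e [_ [D /countable_injP[f finj] dD] _ reB [einj ec eo]]]]].
(* Since [f] is injective on [D], this union holds at most one ball: its centre has code [i.1] and
   its radius is [1/(i.2+1)]. *)
pose U (i : nat * nat) := \bigcup_(d in [set d | D d /\ f d = i.1])
  e @^-1` ((ball d (i.2.+1%:R^-1 : R))°).
apply: (@is_base_countType X _ U).
  move=> i; apply: bigcup_open => d _.
  by move/continuousP: ec; apply; exact: open_interior.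
move=> x V; rewrite nbhsE => -[U0 [oU0 U0x] U0V].
have [V0 oV0 eU0] := eo _ oU0.
have V0ex : V0 (e x).
  have : (e @` U0) (e x) by exists x.
  by rewrite eU0 => -[].
have /nbhs_ballP[r /= r0 rV0] : nbhs (e x) V0 by exact: open_nbhs_nbhs.
have [m mr] : exists m, m.+1%:R^-1 < r / 2.
  have /ltr_add_invr[m] : 0 < r / 2 by rewrite divr_gt0.
  by rewrite add0r; exists m.
have m0 : (0 : R) < m.+1%:R^-1 by rewrite invr_gt0.
(* A centre within half the radius of [e x]: its ball contains a neighbourhood of [e x] and stays
   within three half-radii, hence within [r], of [e x]. *)
have [d [/interior_subset dball Dd]] :
    (ball (e x) (m.+1%:R^-1 / 2 : R))° `&` D !=set0.
  apply: dD; last exact: open_interior.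
  by exists (e x); apply: nbhsx_ballx; rewrite divr_gt0.
exists (f d, m); split.
  exists d => //=; rewrite /interior.
  apply: filterS (nbhsx_ballx (e x) (m.+1%:R^-1 / 2) _); last by rewrite divr_gt0.
  move=> z xz; rewrite (splitr (m.+1%:R^-1)).
  by apply: ball_triangle xz; exact: ball_sym.
move=> y [d' /= [Dd' fd'] /interior_subset d'y]; apply: U0V.
have dd' : d' = d by apply: finj; rewrite ?inE.
rewrite {}dd' in d'y.
have : (e @` U0) (e y).
  rewrite eU0; split; last by rewrite -reB; exists y.
  apply: rV0; apply: (@le_ball _ _ _ (m.+1%:R^-1 / 2 + m.+1%:R^-1)).
    by move: m0 mr; set q := m.+1%:R^-1; lra.
  exact: ball_triangle d'y.
by move=> [y' U0y' /einj <-].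
Qed.

(** Indices stay pairs here; [is_base_countType] renumbers them where a sequence is wanted. *)
Lemma is_base_prod (X Y : topologicalType) (U : nat -> set X)
    (V : nat -> set Y) :
  is_base U -> is_base V ->
  (forall i : nat * nat, open (U i.1 `*` V i.2)) /\
  forall p W, nbhs p W ->
    exists i : nat * nat, (U i.1 `*` V i.2) p /\ U i.1 `*` V i.2 `<=` W.
Proof.
move=> [oU bU] [oV bV]; split=> [i|[x y] W].
  rewrite openE => -[x y] /= [Ux Vy]; exists (U i.1, V i.2) => //=.
  by split; apply: open_nbhs_nbhs; split.
move=> [[W1 W2] /= [xW1 yW2] sW].
have [i [Uix UiW]] := bU _ _ xW1; have [j [Vjy VjW]] := bV _ _ yW2.
exists (i, j) => /=; split=> // -[a b] [/= /UiW a1 /VjW b2].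
exact: (sW (a, b)).
Qed.

(** Turns continuity along sequences into statements on neighbourhoods. If [D] is no neighbourhood,
    each finite intersection [V n] of base sets around [p] has a point outside [D]; these points
    converge to [p]. *)
Lemma nbhs_seqP (X : topologicalType) (U : nat -> set X) (p : X) (D : set X) :
  is_base U ->
  (forall s : nat -> X, s @ \oo --> p -> exists n, D (s n)) -> nbhs p D.
Proof.
move=> [oU bU] sD; apply: contrapT => nD.
pose V n := [set x | forall i, (i <= n)%N -> U i p -> U i x].
have nV n : nbhs p (V n).
  elim: n => [|n IHn].
    have [U0p|U0p] := pselect (U 0%N p); last first.
      by apply: filterS filterT => x _ i; rewrite leqn0 => /eqP ->.
    apply: (@filterS _ _ _ (U 0%N)); last by apply: open_nbhs_nbhs.
    by move=> x Ux i; rewrite leqn0 => /eqP ->.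
  have [Unp|Unp] := pselect (U n.+1 p); last first.
    apply: filterS IHn => x Vx i; rewrite leq_eqVlt => /predU1P[->//|].
    by rewrite ltnS; exact: Vx.
  apply: filterS2 IHn (_ : nbhs p (U n.+1)) => [x Vx Ux i|]; last first.
    exact: open_nbhs_nbhs.
  by rewrite leq_eqVlt => /predU1P[->//|]; rewrite ltnS; exact: Vx.
have /choice[s sP] n : exists x, V n x /\ ~ D x.
  apply: contrapT => /forallNP h; apply: nD; apply: filterS (nV n) => x Vx.
  by apply: contrapT => nDx; exact: (h x).
have [n Dn] : exists n, D (s n).
  apply: sD => W /bU[i [Uip UiW]]; exists i => //= n /= ilen.
  by apply: UiW; apply: (sP n).1.
exact: (sP n).2.
Qed.

Lemma is_base_dense (X : ptopologicalType) (U : nat -> set X) : is_base U ->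
  exists a : nat -> X, forall (x : X) (V : set X), nbhs x V -> exists n, V (a n).
Proof.
move=> [oU bU]; exists (fun n => get (U n)) => x V /bU[n [Unx UnV]].
by exists n; apply: UnV; apply: getI Unx.
Qed.

(** With countable bases an open set is a countable union of open rectangles, so it belongs to the
    product of the Borel sigma-algebras. *)
Lemma open_measurable_prod (X Y : ptopologicalType) (U : nat -> set X)
    (V : nat -> set Y) (O : set (X * Y)) :
  is_base U -> is_base V -> open O ->
  measurable (O : set (borel X * borel Y)%type).
Proof.
move=> bU bV oO.
have -> : O = \bigcup_i \bigcup_(j in [set j | U i `*` V j `<=` O])
    (U i `*` V j).
  apply/seteqP; split=> [p Op|p [i _ [j /= ijO]] /ijO//].
  have [[i j] /= [ip iO]] :=
    (is_base_prod bU bV).2 p O (open_nbhs_nbhs (conj oO Op)).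
  by exists i => //; exists j.
apply: bigcup_measurable => i _; apply: bigcup_measurable => j _.
apply: (@measurableX _ _ (borel X) (borel Y)); apply: sub_sigma_algebra.
  exact: bU.1.
exact: bV.1.
Qed.

Lemma usc_open (X : topologicalType) (R : realType) (g : X -> R) (a : R) :
  usc g -> open [set x | g x < a].
Proof.
move=> ug; rewrite openE => x /= /ug[V xV Va].
by apply: filterS xV.
Qed.

Lemma usc_measurable (X : ptopologicalType) (R : realType) (g : X -> R) :
  usc g -> measurable_fun setT (g : borel X -> R).
Proof.
move=> ug; apply: (measurability _ (RGenInftyO.measurableE R)) => //.
move=> _ [_ [r ->] <-]; rewrite setTI; apply: sub_sigma_algebra.
rewrite (_ : _ @^-1` _ = [set x | g x < r]); first exact: usc_open.
by apply/seteqP; split=> x /=; rewrite in_itv.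
Qed.

Lemma usc_measurable_prod (X Y : ptopologicalType) (R : realType)
    (U : nat -> set X) (V : nat -> set Y) (g : X * Y -> R) :
  is_base U -> is_base V -> usc g ->
  measurable_fun setT (g : (borel X * borel Y)%type -> R).
Proof.
move=> bU bV ug; apply: (measurability _ (RGenInftyO.measurableE R)) => //.
move=> _ [_ [r ->] <-]; rewrite setTI.
apply: open_measurable_prod bU bV _.
rewrite (_ : _ @^-1` _ = [set x | g x < r]); first exact: usc_open.
by apply/seteqP; split=> x /=; rewrite in_itv.
Qed.

(** * Setwise close probabilities and densities *)

Lemma bounded_measurable_integrable d (X : measurableType d) (R : realType)
    (P : probability X R) (h : X -> R) (C : R) :
  measurable_fun setT h -> (forall x, `|h x| <= C) ->
  P.-integrable setT (EFin \o h).
Proof.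
move=> mh hC; apply: measurable_bounded_integrable => //.
  by rewrite -ge0_fin_numE// fin_num_measure.
exists C; split; first exact: num_real.
by move=> x Cx y _; exact: le_trans (hC y) (ltW Cx).
Qed.

(* Equals [min n (floor x)] for [0 <= x]. Applied to [n * h] and divided by
   [n], it is a step function within [1 / n] of [h] whose level sets reduce the
   comparison of integrals to the comparison of probabilities of events. *)
Definition level_count (R : realType) (n : nat) (x : R) : R :=
  \sum_(i < n) (i.+1%:R <= x)%R%:R.

Lemma level_countP (R : realType) (n : nat) (x : R) : 0 <= x ->
  [/\ level_count n x <= x, level_count n x <= n%:R &
      x <= level_count n x + 1 \/ level_count n x = n%:R].
Proof.
move=> x0; rewrite /level_count; elim: n => [|n [Sx Sn H]].
  by rewrite big_ord0; split=> //; right.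
rewrite big_ord_recr /= -[n.+1]addn1 natrD.
set s := \sum_(i < n) _ in Sx Sn H *.
case: (lerP (n%:R + 1) x) => nx /=; last first.
  rewrite addr0; split=> //; first by lra.
  by left; case: H => // H; lra.
have -> : s = n%:R by case: H => // H; lra.
by split=> //; right.
Qed.

Lemma Rintegral_probability_cst d (X : measurableType d) (R : realType)
    (P : probability X R) (k : R) : \int[P]_x (cst k x) = k.
Proof.
by rewrite Rintegral_cst// -[fine _]/(fine (P setT)) probability_setT mulr1.
Qed.

Section setwise_close.
Context d (X : measurableType d) (R : realType) (P Q : probability X R).
Variable dlt : R.
Hypothesis PQ : forall E, measurable E -> fine (P E) <= fine (Q E) + dlt.

Let level_set n (h : X -> R) (i : nat) := [set x | i.+1%:R <= n%:R * h x].

Let mlevel_set n (h : X -> R) i :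
  measurable_fun setT h -> measurable (level_set n h i).
Proof.
move=> mh; rewrite -[X in measurable X]setTI.
have := @measurable_fun_ler _ X R setT (cst i.+1%:R) (fun x => n%:R * h x).
by move=> /(_ _ _ measurableT [set true]); apply => //; exact: measurable_funM.
Qed.

Let level_countE n (h : X -> R) x :
  level_count n (n%:R * h x) = \sum_(i < n) \1_(level_set n h i) x.
Proof.
apply: eq_bigr => i _; rewrite indicE; congr (_%:R); congr nat_of_bool.
by apply/idP/idP => [|/set_mem//]; exact: mem_set.
Qed.

Let Rintegral_level (mu : probability X R) n (h : X -> R) :
  measurable_fun setT h ->
  \int[mu]_x (level_count n (n%:R * h x)) =
  \sum_(i < n) fine (mu (level_set n h i)).
Proof.
move=> mh; apply: EFin_inj; rewrite -sumEFin /Rintegral.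
under eq_integral => x _ do rewrite level_countE -sumEFin.
rewrite integral_sum//; last first.
  move=> i; apply: (@bounded_measurable_integrable _ _ _ _ _ 1) => [|x].
    by apply: measurable_indic; exact: mlevel_set.
  by rewrite indicE; case: (_ \in _); rewrite ?normr1 ?normr0.
rewrite fineK.
  apply: eq_bigr => i _; rewrite integral_indic//; last exact: mlevel_set.
  by rewrite setIT fineK// fin_num_measure//; exact: mlevel_set.
apply/sum_fin_numP => i _ _; rewrite integral_indic//; last exact: mlevel_set.
by rewrite setIT fin_num_measure//; exact: mlevel_set.
Qed.

(** Each of the [n] level sets costs at most [dlt], and the sum is divided by [n]: the total cost is
    [dlt] plus a rounding error [1/n < e]. *)
Lemma Rintegral_le_setwise01 (h : X -> R) :
  measurable_fun setT h -> (forall x, 0 <= h x <= 1) ->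
  \int[P]_x h x <= \int[Q]_x h x + dlt.
Proof.
move=> mh h01; apply/ler_addgt0Pr => e e0.
have [n /andP[n0 ne]] : exists n, (0 < n)%N && (n%:R^-1 < e).
  have /ltr_add_invr[m] := e0.
  by rewrite add0r; exists m.+1.
have n0' : (0 : R) < n%:R by rewrite ltr0n.
have nh0 x : 0 <= n%:R * h x by case/andP: (h01 x) => *; rewrite mulr_ge0.
have mS : measurable_fun setT (fun x => level_count n (n%:R * h x)).
  under eq_fun do rewrite level_countE.
  by apply: measurable_sum => i; apply: measurable_indic; exact: mlevel_set.
have S0 x : 0 <= level_count n (n%:R * h x) by apply: sumr_ge0.
have iS (mu : probability X R) :
    mu.-integrable setT (EFin \o (fun x => level_count n (n%:R * h x))).
  apply: (@bounded_measurable_integrable _ _ _ _ _ n%:R) => // x.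
  by rewrite ger0_norm//; have [] := level_countP n (nh0 x).
have ih (mu : probability X R) (k : R) :
    mu.-integrable setT (EFin \o (fun x => k * h x)).
  apply: (@bounded_measurable_integrable _ _ _ _ _ `|k|) => [|x].
    exact: measurable_funM.
  by rewrite normrM ler_piMr// ger0_norm//; case/andP: (h01 x).
have ih1 (mu : probability X R) : mu.-integrable setT (EFin \o h).
  have := ih mu 1; congr (_.-integrable _ _).
  by apply/funext => x /=; rewrite mul1r.
have i1 (mu : probability X R) : mu.-integrable setT (EFin \o (cst (1 : R))).
  exact: finite_measure_integrable_cst.
have upper : n%:R * \int[P]_x h x <=
    \int[P]_x (level_count n (n%:R * h x)) + 1.
  rewrite -(RintegralZl _ measurableT (ih1 P)).
  apply: (@le_trans _ _ (\int[P]_x (level_count n (n%:R * h x) + cst 1 x))).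
    apply: (le_Rintegral measurableT (ih P _)
      (integrableD measurableT (iS P) (i1 P))) => x _.
    have [_ _ [//|->]] := level_countP n (nh0 x).
    have /andP[_ h1] := h01 x.
    by rewrite (@le_trans _ _ n%:R) ?lerDl// ler_piMr.
  by rewrite (RintegralD measurableT (iS P) (i1 P)) Rintegral_probability_cst.
have lower : \int[Q]_x (level_count n (n%:R * h x)) <= n%:R * \int[Q]_x h x.
  rewrite -(RintegralZl _ measurableT (ih1 Q)).
  apply: (le_Rintegral measurableT (iS Q) (ih Q _)) => x _.
  by have [] := level_countP n (nh0 x).
have mid : \int[P]_x (level_count n (n%:R * h x)) <=
    \int[Q]_x (level_count n (n%:R * h x)) + n%:R * dlt.
  rewrite !Rintegral_level// mulr_natl -[X in dlt *+ X](card_ord n).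
  rewrite -sumr_const -big_split/=.
  by apply: ler_sum => i _; apply: PQ; exact: mlevel_set.
rewrite -(@ler_pM2l _ n%:R)// !mulrDr.
have : 1 <= n%:R * e by rewrite -ler_pdivrMl// mulr1 ltW.
lra.
Qed.

(** The function [(h + C) / (2C)] takes values in [[0, 1]]; undoing this rescaling gives the factor
    [2C]. *)
Lemma Rintegral_le_setwise (h : X -> R) (C : R) : 0 < C ->
  measurable_fun setT h -> (forall x, `|h x| <= C) ->
  \int[P]_x h x <= \int[Q]_x h x + 2 * C * dlt.
Proof.
move=> C0 mh hC.
have C2 : 0 < 2 * C by rewrite mulr_gt0.
have ih (mu : probability X R) : mu.-integrable setT (EFin \o h).
  exact: bounded_measurable_integrable hC.
have ic (mu : probability X R) : mu.-integrable setT (EFin \o (cst C)).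
  exact: finite_measure_integrable_cst.
have ihc (mu : probability X R) :
    mu.-integrable setT (EFin \o (fun x => h x + cst C x)).
  exact: (integrableD measurableT (ih mu) (ic mu)).
have E (mu : probability X R) :
    \int[mu]_x ((2 * C)^-1 * (h x + cst C x)) =
    (2 * C)^-1 * (\int[mu]_x h x + C).
  rewrite (RintegralZl _ measurableT (ihc mu)).
  by rewrite (RintegralD measurableT (ih mu) (ic mu)) Rintegral_probability_cst.
have := @Rintegral_le_setwise01 (fun x => (2 * C)^-1 * (h x + cst C x)).
rewrite !E => H.
have {}H : (2 * C)^-1 * (\int[P]_x h x + C) <=
    (2 * C)^-1 * (\int[Q]_x h x + C) + dlt.
  apply: H => [|x].
    by apply: measurable_funM => //; exact: measurable_funD.
  have := hC x; rewrite ler_norml => /andP[h1 h2].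
  rewrite mulr_ge0 ?invr_ge0 ?(ltW C2)//=; last by rewrite /cst; lra.
  by rewrite -ler_pdivlMl ?invr_gt0// invrK mulr1 /cst; lra.
move: H; rewrite -(@ler_pM2l _ (2 * C))// [2 * C * (_ + dlt)]mulrDr.
rewrite !mulVKf ?gt_eqF//.
lra.
Qed.

End setwise_close.

(** The partition into [E] and its complement is one competitor in the supremum, and its first term
    already is the wanted difference. *)
Lemma tv_dist_setwise (R : realType) (S : ptopologicalType)
    (P Q : probability (borel S) R) (dlt : R) :
  (tv_dist P Q < dlt%:E)%E -> forall E : set (borel S), measurable E ->
  `|fine (P E) - fine (Q E)| <= dlt.
Proof.
move=> PQ E mE; rewrite -lee_fin; apply/ltW; apply: le_lt_trans PQ.
pose F (i : nat) : set (borel S) := if i == 0%N then E else ~` E.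
apply: (@le_trans _ _ (\sum_(i < 2) `|P (F i) - Q (F i)|)%E).
  rewrite big_ord_recl /F /= -[leLHS]adde0; apply: leeD.
    by rewrite -(fineK (fin_num_measure P _ mE)) -(fineK (fin_num_measure Q _ mE)).
  exact: sume_ge0.
apply: ereal_sup_ubound; exists 2%N, F; split=> //.
- by move=> i _; rewrite /F; case: ifP => // _; exact: measurableC.
- move=> [|[|i]] [|[|j]] //= _ _ _; rewrite /F /=.
    exact: setICr.
  exact: setICl.
- apply/seteqP; split=> // y _; have [Ey|Ey] := pselect (E y).
    by exists 0%N.
  by exists 1%N.
Qed.

(** * Transfer of bounded densities between close probabilities *)

Section density.
Context d (X : measurableType d) (R : realType).
Implicit Types (P Q : probability X R) (j nu : X -> R).

(** Unlike in [Ralpha] the bounds hold at every point, so they survive integration against another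
    probability. *)
Definition is_density P (M : R) nu :=
  [/\ measurable_fun setT nu, forall x, 0 <= nu x <= M &
      \int[P]_x nu x = 1].

Lemma is_density_integrable P Q M nu : is_density P M nu ->
  Q.-integrable setT (EFin \o nu).
Proof.
move=> [mnu nuM _]; apply: (@bounded_measurable_integrable _ _ _ Q nu M) => // x.
by have /andP[nu0 ?] := nuM x; rewrite ger0_norm.
Qed.

Lemma integrableM_density P Q M nu j C : is_density P M nu ->
  measurable_fun setT j -> (forall x, `|j x| <= C) ->
  Q.-integrable setT (EFin \o (fun x => j x * nu x)).
Proof.
move=> [mnu nuM _] mj jC.
apply: (@bounded_measurable_integrable _ _ _ _ _ (C * M)) => [|x].
  exact: measurable_funM.
have /andP[nu0 ?] := nuM x.
by rewrite normrM ler_pM// ger0_norm.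
Qed.

(** If the [Q]-mass [m] of [nu] is at least 1, divide by [m]; otherwise mix with the constant [M].
    Either way [nu - nu'] has constant sign, so its L^1 norm is [|m - 1| <= K]. *)
Lemma density_perturb P Q M nu K : 1 <= M -> is_density P M nu ->
  `|\int[Q]_x nu x - 1| <= K ->
  exists2 nu', is_density Q M nu' & forall j C, measurable_fun setT j ->
    (forall x, `|j x| <= C) ->
    \int[Q]_x (j x * nu x) <= \int[Q]_x (j x * nu' x) + C * K.
Proof.
move=> M1 dnu; set m := \int[Q]_x nu x => mK.
have [mnu nuM _] := dnu.
have inu := is_density_integrable Q dnu.
have icst k : Q.-integrable setT (EFin \o (cst k : X -> R)).
  exact: finite_measure_integrable_cst.
have iaff a b : Q.-integrable setT (EFin \o (fun x => a * nu x + cst b x)).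
  exact: (integrableD measurableT (integrableZl measurableT a inu) (icst b)).
have Eaff a b : \int[Q]_x (a * nu x + cst b x) = a * m + b.
  rewrite (RintegralD measurableT (integrableZl measurableT a inu) (icst b)).
  by rewrite (RintegralZl _ measurableT inu) Rintegral_probability_cst.
(* It suffices to find an affine image of [nu] that lies on one side of it. *)
suff [a [b [s [abm sK abM sgn]]]] : exists a b s : R,
    [/\ a * m + b = 1, s * (m - 1) <= K,
        forall y, 0 <= y <= M -> 0 <= a * y + b <= M &
        forall y, 0 <= y <= M -> `|y - (a * y + b)| <= s * (y - (a * y + b))].
  have dnu' : is_density Q M (fun x => a * nu x + cst b x).
    split=> [|x|]; last by rewrite Eaff.
      by apply: measurable_funD => //; exact: measurable_funM.
    exact: abM.
  exists (fun x => a * nu x + cst b x) => // j C mj jC.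
  rewrite -lerBlDl.
  have i1 := integrableM_density Q dnu mj jC.
  have i2 := integrableM_density Q dnu' mj jC.
  rewrite -(RintegralB measurableT i1 i2).
  apply: (@le_trans _ _ (C * (s * (m - 1)))); last first.
    (* Deducing [0 <= C] from [jC] takes a point of [X]; one exists because [P] has mass 1. *)
    have [x0|nX] := pselect (inhabited X); last first.
      exfalso; have : P setT = 0%E.
        rewrite (_ : setT = set0) ?measure0//.
        by apply/seteqP; split=> // x _; apply: nX; exists.
      by rewrite probability_setT => /eqP; rewrite onee_eq0.
    by case: x0 => x0; rewrite ler_wpM2l// (le_trans _ (jC x0)).
  (* The integrand is [C * s] times [nu - nu'], which dominates [j] times [nu - nu'] by [sgn]. *)
  have -> : C * (s * (m - 1)) =
      \int[Q]_x (C * s * (1 - a) * nu x + cst (- (C * s * b)) x).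
    by rewrite Eaff (_ : b = 1 - a * m); [ring | rewrite -abm addrC addKr].
  apply: le_Rintegral => //.
    exact: (integrableB measurableT i1 i2).
  move=> x _ /=; rewrite -mulrBr.
  apply: (le_trans (ler_norm _)); rewrite normrM.
  apply: (le_trans (ler_pM _ _ (jC x) (sgn _ (nuM x)))) => //.
  by rewrite /cst; lra.
have m0 : 0 <= m by apply: Rintegral_ge0 => x _; case/andP: (nuM x).
have [m1|m1] := lerP 1 m.
  (* Scaling down: [nu'] lies below [nu], so the sign is [s = 1]. *)
  exists m^-1, 0, 1; split.
  - by rewrite addr0 mulVf// gt_eqF// (lt_le_trans ltr01).
  - by rewrite mul1r (le_trans (ler_norm _)).
  - move=> y /andP[y0 yM]; rewrite addr0 mulr_ge0 ?invr_ge0//=.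
    by rewrite (le_trans _ yM)// ler_piMl// invf_le1// (lt_le_trans ltr01).
  - move=> y /andP[y0 yM]; rewrite mul1r ger0_norm// addr0 subr_ge0.
    by rewrite ler_piMl// invf_le1// (lt_le_trans ltr01).
have Mm : 0 < M - m by lra.
(* The mixing weight solves [(1 - l) m + l M = 1]; moving towards [M] raises [nu], so the sign is
   [-1]. *)
pose l := (1 - m) / (M - m).
have l0 : 0 <= l by rewrite divr_ge0; lra.
have l1 : l <= 1 by rewrite ler_pdivrMr//; lra.
exists (1 - l), (l * M), (-1); split.
- by have : l * (M - m) = 1 - m by [rewrite divfK// gt_eqF|]; lra.
- by apply: le_trans mK; rewrite mulN1r -normrN ler_norm.
- by move=> y /andP[y0 yM]; apply/andP; split; nra.
- move=> y /andP[y0 yM].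
  have : y - ((1 - l) * y + l * M) <= 0 by nra.
  by move=> /ler0_norm ->; rewrite mulN1r.
Qed.

(** Testing with [nu] shows a mass error of at most [2 M dlt], whose correction costs [2 C M dlt];
    testing with the product of [j] and [nu], bounded by [C M], costs the other [2 C M dlt]. *)
Lemma density_close P Q M nu dlt : 1 <= M -> is_density P M nu ->
  (forall E, measurable E -> `|fine (P E) - fine (Q E)| <= dlt) ->
  exists2 nu', is_density Q M nu' & forall j C, 0 < C ->
    measurable_fun setT j -> (forall x, `|j x| <= C) ->
    \int[P]_x (j x * nu x) <= \int[Q]_x (j x * nu' x) + 4 * C * M * dlt.
Proof.
move=> M1 dnu PQ; have [mnu nuM nu1] := dnu.
have M0 : 0 < M by lra.
have hPQ E : measurable E -> fine (P E) <= fine (Q E) + dlt.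
  by move=> /PQ; rewrite ler_norml => /andP[_]; lra.
have hQP E : measurable E -> fine (Q E) <= fine (P E) + dlt.
  by move=> /PQ; rewrite ler_norml => /andP[+ _]; lra.
have nuM' x : `|nu x| <= M by have /andP[? ?] := nuM x; rewrite ger0_norm.
have [|nu' dnu' H] := @density_perturb P Q M nu (2 * M * dlt) M1 dnu.
  rewrite ler_norml; apply/andP; split.
    have := Rintegral_le_setwise hPQ M0 mnu nuM'; rewrite nu1; lra.
  have := Rintegral_le_setwise hQP M0 mnu nuM'; rewrite nu1; lra.
exists nu' => // j C C0 mj jC; have {H} := H j C mj jC.
have CM : 0 < C * M by exact: mulr_gt0.
have := @Rintegral_le_setwise _ _ _ P Q dlt hPQ (fun x => j x * nu x) _ CM.
have mjn : measurable_fun setT (fun x => j x * nu x) by exact: measurable_funM.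
have jn x : `|j x * nu x| <= C * M.
  by rewrite normrM ler_pM.
move=> /(_ mjn jn); lra.
Qed.

End density.

(** * The one-step risk operator *)

Lemma lee_norm_fin (R : realType) (x : \bar R) (C : R) :
  (`|x| <= C%:E)%E = ((- C)%:E <= x <= C%:E)%E.
Proof. by case: x => [r| |] //=; rewrite ?lee_fin ?ler_norml ?leye_eq ?andbF. Qed.

Section risk_operator.
Context (R : realType) (T : nat) (S A W : ptopologicalType).
Variables (f : S -> A -> W -> S) (PD : probability (borel W) R) (alpha : R).
Hypothesis mf : measurable_fun [set: (borel S * borel A * borel W)%type]
  (fun p : (borel S * borel A * borel W)%type =>
    (f p.1.1 p.1.2 p.2 : borel S)).
Hypothesis halpha : 0 < alpha <= 1.

Let M := powR alpha (- (T%:R^-1)).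

(** Makes the constant 1 an admissible density and leaves room for mixing with [M]. *)
Lemma level_ge1 : 1 <= M.
Proof.
case/andP: halpha => a0 a1.
have le1 : alpha `^ T%:R^-1 <= 1.
  rewrite [leRHS](_ : 1 = 1 `^ (T%:R^-1)); last by rewrite powR1.
  by apply: ge0_ler_powR; rewrite ?nnegrE ?invr_ge0// ltW.
rewrite /M powRN -[leLHS]invr1 lef_pV2// posrE//.
exact: powR_gt0.
Qed.

Lemma measurable_transition (x : S) (u : A) :
  measurable_fun setT (f x u : borel W -> borel S).
Proof.
exact: (measurableT_comp mf
  (@pair1_measurable _ _ (borel S * borel A)%type (borel W) (x, u))).
Qed.

Definition transition_mfun (x : S) (u : A) : {mfun borel W >-> borel S} :=
  HB.pack (f x u : borel W -> borel S)
    (isMeasurableFun.Build _ _ _ _ _ (measurable_transition x u)).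

(** [Qk] is a bare set function; written as the law of [f x u] under [PD], it carries the structure
    of a probability. *)
Definition Qp (x : S) (u : A) : probability (borel S) R :=
  distribution PD (transition_mfun x u).

Lemma QpE x u : Qk f PD x u = Qp x u :> (set (borel S) -> \bar R).
Proof. by []. Qed.

(* Elements of [Ralpha] are bounded by [M] only up to a null set; clamping them
   changes no integral and makes all bounds hold everywhere. *)
Definition clamp (nu : S -> R) : S -> R := fun y => Num.max 0 (Num.min M (nu y)).

Lemma clamp_itv nu y : 0 <= clamp nu y <= M.
Proof.
rewrite /clamp le_max lexx/= ge_max ge_min lexx/= andbT.
exact: le_trans ler01 level_ge1.
Qed.

Lemma clamp_id nu y : 0 <= nu y <= M -> clamp nu y = nu y.
Proof. by move=> /andP[nu0 nuM]; rewrite /clamp min_r// max_r. Qed.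

Lemma measurable_clamp d (X : measurableType d) (g : X -> R) :
  measurable_fun setT g ->
  measurable_fun setT (fun x => Num.max 0 (Num.min M (g x))).
Proof.
move=> mg; apply: measurable_maxr => //.
exact: measurable_minr.
Qed.

Lemma clamp_integral x u nu (j : S -> R) : Ralpha T f PD alpha x u nu ->
  measurable_fun setT (j : borel S -> R) ->
  (\int[Qk f PD x u]_y ((j y)%:E * (nu y)%:E) =
   \int[Qp x u]_y (j y * clamp nu y)%:E)%E.
Proof.
move=> [mnu [N [mN QN] nuN] _] mj; rewrite QpE.
have mc : measurable_fun setT (clamp nu : borel S -> R) by exact: measurable_clamp.
apply: ae_eq_integral => //.
- by apply/measurable_EFinP; exact: measurable_funM.
- by apply/measurable_EFinP; exact: measurable_funM.
exists N; split=> // y /= hy; apply: nuN => /= nuy; apply: hy => _.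
by rewrite clamp_id// EFinM.
Qed.

Lemma clamp_density x u nu : Ralpha T f PD alpha x u nu ->
  is_density (Qp x u) M (clamp nu).
Proof.
move=> hnu; have [mnu _ int1] := hnu; split.
- exact: measurable_clamp.
- exact: clamp_itv.
(* Clamping preserves the total mass: this is the case of the test function 1. *)
have := @clamp_integral x u nu (fun=> 1) hnu (measurable_cst _).
rewrite QpE; under eq_integral do rewrite /= mul1e.
rewrite -QpE int1 /Rintegral => H.
under eq_integral do rewrite -[clamp nu _]mul1r.
by rewrite -H.
Qed.

Lemma density_Ralpha x u nu : is_density (Qp x u) M nu ->
  Ralpha T f PD alpha x u nu.
Proof.
move=> dnu; have [mnu nuM int1] := dnu; split=> //.
  by exists set0; [split; rewrite // QpE measure0|] => y /=; rewrite nuM.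
rewrite QpE -[LHS]fineK; first by rewrite -[fine _]/(\int[Qp x u]_y nu y) int1.
exact/integrable_fin_num/is_density_integrable/dnu.
Qed.

Section bounded_value.
Variables (j : S -> R) (C : R).
Hypotheses (mj : measurable_fun setT (j : borel S -> R))
  (C0 : 0 < C) (jC : forall y, `|j y| <= C).

Let phi x u := phi_op T f PD alpha (EFin \o j) x u.

(** Clamping turns a member of [Ralpha] into a density with the same integral, and every density is
    a member of [Ralpha]; all integrals are then real. *)
Lemma phi_op_density x u : phi x u =
  ereal_sup [set (\int[Qp x u]_y (j y * nu y))%:E | nu in
    is_density (Qp x u) M].
Proof.
congr ereal_sup; apply/seteqP; split=> _ [nu hnu <-].
  exists (clamp nu); first exact: clamp_density.
  rewrite clamp_integral// fineK//.
  exact/integrable_fin_num/(integrableM_density _ (clamp_density hnu) mj jC).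
have rnu := density_Ralpha hnu; exists nu => //.
rewrite clamp_integral//.
have [_ nuM _] := hnu.
under eq_integral => y _ do rewrite clamp_id//.
rewrite fineK//.
exact/integrable_fin_num/(integrableM_density _ hnu mj jC).
Qed.

Lemma phi_op_bounded x u : (`|phi x u| <= C%:E)%E.
Proof.
rewrite phi_op_density.
have jnu nu : is_density (Qp x u) M nu -> `|\int[Qp x u]_y (j y * nu y)| <= C.
  move=> dnu; have [_ nuM int1] := dnu.
  have inu := is_density_integrable (Qp x u) dnu.
  have ijnu := integrableM_density (Qp x u) dnu mj jC.
  rewrite (le_trans (le_normr_Rintegral measurableT ijnu))//.
  rewrite -[leRHS]mulr1 -int1 -(RintegralZl _ measurableT inu).
  apply: le_Rintegral => //.
  - exact: (integrable_norm ijnu).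
  - exact: (integrableZl measurableT C inu).
  - move=> y _; have /andP[nu0 _] := nuM y.
    by rewrite normrM [X in _ * X]ger0_norm// ler_wpM2r.
(* A competitor that keeps the supremum away from [-oo]. *)
have d1 : is_density (Qp x u) M (cst 1).
  split=> //; last exact: Rintegral_probability_cst.
  by move=> y; rewrite ler01 level_ge1.
rewrite lee_norm_fin; apply/andP; split; last first.
  apply: ge_ereal_sup => _ [nu dnu <-]; rewrite lee_fin.
  exact: le_trans (ler_norm _) (jnu _ dnu).
apply: (@le_trans _ _ (\int[Qp x u]_y (j y * cst 1 y))%:E).
  by rewrite lee_fin lerNl; have := jnu _ d1; rewrite ler_norml => /andP[]; lra.
by apply: ereal_sup_ubound; exists (cst 1).
Qed.


Lemma phi_op_close x u x' u' dlt :
  (forall E : set (borel S), measurable E ->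
    `|fine (Qp x' u' E) - fine (Qp x u E)| <= dlt) ->
  (phi x' u' <= phi x u + (4 * C * M * dlt)%:E)%E.
Proof.
move=> QQ; rewrite !phi_op_density; apply: ge_ereal_sup => _ [nu dnu <-].
have [nu' dnu' H] := density_close level_ge1 dnu QQ.
apply: (@le_trans _ _
    ((\int[Qp x u]_y (j y * nu' y))%:E + (4 * C * M * dlt)%:E)%E).
  by rewrite -EFinD lee_fin; exact: H.
by rewrite leeD2r//; apply: ereal_sup_ubound; exists nu'.
Qed.

End bounded_value.
End risk_operator.

(** * The path measure of a Markov policy *)

Section kernel_precomp.
Context d1 d2 d3 (X : measurableType d1) (Y : measurableType d2)
  (Z : measurableType d3) (R : realType).
Variables (k : R.-pker Y ~> Z) (F : X -> Y).

(** Carrying the proof [mF] in the term lets the kernel instances below be inferred from it. *)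
Definition kprecomp (mF : measurable_fun setT F) (x : X) :
  {measure set Z -> \bar R} := k (F x).

Hypothesis mF : measurable_fun setT F.

Let measurable_kprecomp U : measurable U ->
  measurable_fun setT (kprecomp mF ^~ U).
Proof. by move=> mU; exact: measurableT_comp (measurable_kernel k U mU) mF. Qed.

HB.instance Definition _ :=
  isKernel.Build _ _ X Z R (kprecomp mF) measurable_kprecomp.

Let kprecomp_prob x : kprecomp mF x setT = 1%E.
Proof. exact: prob_kernel. Qed.

HB.instance Definition _ :=
  Kernel_isProbability.Build _ _ X Z R (kprecomp mF) kprecomp_prob.

End kernel_precomp.

Section kernel_comp_probability.
Context d1 d2 d3 (X : measurableType d1) (Y : measurableType d2)
  (Z : measurableType d3) (R : realType).
Variables (l : R.-pker X ~> Y) (k : R.-pker (X * Y) ~> Z).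

Let mkcomp_prob x : mkcomp l k x setT = 1%E.
Proof.
transitivity (\int[l x]_y cst 1 y)%E.
  by apply: eq_integral => y _; exact: prob_kernel.
by rewrite integral_cst// mul1e prob_kernel.
Qed.

HB.instance Definition _ :=
  Kernel_isProbability.Build _ _ X Z R (mkcomp l k) mkcomp_prob.

End kernel_comp_probability.

Section measure_probability.
Context d (X : measurableType d) (R : realType).
Variables (m : {measure set X -> \bar R}).

(** A copy of [m] that carries the proof [m1], to which the probability structure is attached. *)
Definition unit_mass (m1 : m setT = 1%E) : set X -> \bar R := m.

Hypothesis m1 : m setT = 1%E.

HB.instance Definition _ := isMeasure.Build _ _ _ (unit_mass m1)
  (measure0 m) (measure_ge0 m) (@measure_semi_sigma_additive _ _ _ m).

HB.instance Definition _ := Measure_isProbability.Build _ _ _ (unit_mass m1) m1.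

Definition measure_probability : probability X R := unit_mass m1.

End measure_probability.

(** * Measurability on the space of trajectories *)

Section trajectories.
Context (T : nat) (S A : ptopologicalType).
Local Notation Om := (Omega T S A).

Lemma measurable_state t : (t <= T)%N ->
  measurable_fun setT (fun w : Om => (w.1 t : borel S)).
Proof.
move=> tT _ B mB; rewrite setTI; apply: sub_sigma_algebra.
by left; exists t, B.
Qed.

Lemma measurable_action t : (t < T)%N ->
  measurable_fun setT (fun w : Om => (w.2 t : borel A)).
Proof.
move=> tT _ B mB; rewrite setTI; apply: sub_sigma_algebra.
by right; exists t, B.
Qed.

Lemma measurable_traj d (X : measurableType d) (F : X -> traj S A) :
  (forall t, (t <= T)%N -> measurable_fun setT (fun x => ((F x).1 t : borel S))) ->
  (forall t, (t < T)%N -> measurable_fun setT (fun x => ((F x).2 t : borel A))) ->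
  measurable_fun setT (F : X -> Om).
Proof.
move=> mS mA; apply: (@measurability _ _ X Om setT F (@omega_gen T S A)) => //.
move=> _ [_ [|] [t [B [tT mB ->]]] <-].
  exact: mS.
exact: mA.
Qed.

Lemma measurable_upd d (X : measurableType d) (F : X -> Om) t
    (u : X -> borel A) (y : X -> borel S) :
  measurable_fun setT F -> measurable_fun setT u -> measurable_fun setT y ->
  measurable_fun setT (fun x => upd (F x) t (u x) (y x) : Om).
Proof.
move=> mF mu my; apply: measurable_traj => s sT; rewrite /upd /=.
  case: (s == t.+1) => //.
  exact: (measurableT_comp (measurable_state sT) mF).
case: (s == t) => //.
exact: (measurableT_comp (measurable_action sT) mF).
Qed.

End trajectories.

Section integral_set_function.
Import HBNNSimple.

(* [m1] and [m2] need not be measures: [pathP] is a bare set function, about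
   which nothing is known at non-measurable sets. *)
Lemma eq_integral_set_function d (X : measurableType d) (R : realType)
    (m1 m2 : set X -> \bar R) (h : X -> \bar R) :
  (forall E, measurable E -> m1 E = m2 E) ->
  (\int[m1]_x h x = \int[m2]_x h x)%E.
Proof.
move=> m12.
have sE (s : {nnsfun X >-> R}) : sintegral m1 s = sintegral m2 s.
  by apply: eq_fsbigr => r _; rewrite m12.
rewrite /integral; congr (ereal_sup _ - ereal_sup _)%E;
  by apply/seteqP; split=> _ [s hs <-]; exists s.
Qed.

End integral_set_function.

Section path_measure.
Context (R : realType) (T : nat) (S A W : ptopologicalType).
Variables (f : S -> A -> W -> S) (PD : probability (borel W) R).
Hypothesis mf : measurable_fun [set: (borel S * borel A * borel W)%type]
  (fun p : (borel S * borel A * borel W)%type =>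
    (f p.1.1 p.1.2 p.2 : borel S)).
Hypothesis hT : (0 < T)%N.
Variable g : nat -> S -> A.
Hypothesis mg : forall t, (t < T)%N ->
  measurable_fun setT (fun x : borel S => (g t x : borel A)).
Local Notation Om := (Omega T S A).

(** Driven by a disturbance rather than by a next state, so that every stage integrates against the
    fixed measure [PD]. *)
Definition step (t : nat) (p : Om * borel W) : Om :=
  upd p.1 t (g t (p.1.1 t)) (f (p.1.1 t) (g t (p.1.1 t)) p.2).

Lemma measurable_step t : (t < T)%N -> measurable_fun setT (step t).
Proof.
move=> tT.
have mx : measurable_fun setT (fun p : Om * borel W => (p.1.1 t : borel S)).
  exact: (measurableT_comp (@measurable_state T S A t (ltnW tT))
    (@measurable_fst _ _ Om (borel W))).
have mu : measurable_fun setT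
    (fun p : Om * borel W => (g t (p.1.1 t) : borel A)).
  exact: (measurableT_comp (mg tT) mx).
apply: measurable_upd => //.
exact: (measurableT_comp mf
  (measurable_fun_pair (measurable_fun_pair mx mu) measurable_snd)).
Qed.

Lemma stage_lt k : (T - k.+1 < T)%N.
Proof. by rewrite ltn_subrL. Qed.

(** Here [k] counts the stages left. For [k <= T], [Kern k w] is the law of the trajectory that
    keeps the states of [w] up to time [T - k] and draws the rest, one disturbance per stage. *)
Fixpoint Kern (k : nat) : R.-pker Om ~> Om :=
  match k with
  | 0 => kdirac (@measurable_id _ Om setT)
  | k'.+1 => mkcomp (kprobability (measurable_cst (PD : pprobability (borel W) R)))
      (kprecomp (Kern k') (measurable_step (stage_lt k')))
  end.

Lemma Kern_tower k w (h : Om -> \bar R) : (forall w, 0 <= h w)%E ->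
  measurable_fun setT h ->
  (\int[Kern k.+1 w]_w' h w' =
   \int[PD]_d \int[Kern k (step (T - k.+1) (w, d))]_w' h w')%E.
Proof. by move=> h0 mh; rewrite /= integral_kcomp. Qed.

(** The Dirac integral evaluates at the action [g t x], and a change of variables along [f x u]
    turns the integral over the next state into one over [PD]. *)
Lemma iter_int_Kern k w (E : set Om) : measurable E ->
  iter_int T f PD (markov_policy R g) k (fun w => (\1_E w)%:E) w = Kern k w E.
Proof.
move=> mE; elim: k w => [//|k IHk] w.
rewrite [LHS]/=.
set t := (T - k.+1)%N; set x := w.1 t.
transitivity (\int[\d_(g t x : borel A)]_u
    \int[Qp PD mf x u]_y Kern k (upd w t u y) E)%E.
  apply: eq_integral => u _; rewrite (QpE PD mf).
  by apply: eq_integral => y _; exact: IHk.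
have mK := measurable_kernel (Kern k) E mE.
have mupd : measurable_fun setT
    (fun p : borel A * borel W => Kern k (upd w t p.1 (f x p.1 p.2)) E).
  suff mu : measurable_fun setT
      (fun p : borel A * borel W => upd w t p.1 (f x p.1 p.2) : Om).
    exact: (measurableT_comp mK mu).
  apply: measurable_upd => //.
  exact: (measurableT_comp mf (measurable_fun_pair (measurable_fun_pair
    (measurable_cst (x : borel S)) measurable_fst) measurable_snd)).
have QE u : (\int[Qp PD mf x u]_y Kern k (upd w t u y) E =
    \int[PD]_d Kern k (upd w t u (f x u d)) E)%E.
  rewrite (ge0_integral_pushforward (measurable_transition mf x u))//.
  suff mu : measurable_fun setT (fun y : borel S => upd w t u y : Om).
    exact: (measurableT_comp mK mu).
  exact: measurable_upd.
under eq_integral do rewrite QE.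
(* Evaluating the Dirac integral requires measurability in the action, which Tonelli provides. *)
have mF := measurable_fun_fubini_tonelli_F (m2 := PD) _ mupd
  (fun p => measure_ge0 _ _).
rewrite (integral_dirac _ measurableT mF).
by rewrite diracT mul1e.
Qed.

Lemma pathP_integral x (h : Om -> \bar R) :
  (\int[Defs.pathP f PD x (markov_policy R g)]_w h w =
   \int[Kern T (init_traj A x)]_w h w)%E.
Proof.
by apply: eq_integral_set_function => E mE; rewrite -iter_int_Kern.
Qed.

Definition path_prob k (w : Om) : probability Om R :=
  @measure_probability _ _ _ (Kern k w) (prob_kernel w).

Lemma path_prob0 w (h : Om -> R) : measurable_fun setT h ->
  \int[path_prob 0 w]_w' h w' = h w.
Proof.
move=> mh; rewrite /Rintegral.
rewrite (integral_dirac w measurableT (f := EFin \o h)).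
  by rewrite diracT mul1e.
exact/measurable_EFinP.
Qed.

Section bounded_tower.
Variables (h : Om -> R) (C : R).
Hypotheses (mh : measurable_fun setT h) (hC : forall w, `|h w| <= C).

Lemma path_integral_bounded k w : `|\int[path_prob k w]_w' h w'| <= C.
Proof.
have ih := bounded_measurable_integrable (path_prob k w) mh hC.
rewrite (le_trans (le_normr_Rintegral measurableT ih))//.
rewrite -[leRHS](Rintegral_probability_cst (path_prob k w)).
apply: le_Rintegral => //; first exact: integrable_norm ih.
exact: finite_measure_integrable_cst.
Qed.

(** Adding [C] makes the integrand nonnegative, which brings the bounded signed [h] within reach of
    the kernel lemmas for nonnegative functions. *)
Let shiftE k w :
  ((\int[path_prob k w]_w' h w' + C)%:E = \int[Kern k w]_w' (h w' + C)%:E)%E.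
Proof.
have ih := bounded_measurable_integrable (path_prob k w) mh hC.
have ic : (path_prob k w).-integrable setT (EFin \o (cst C)).
  exact: finite_measure_integrable_cst.
rewrite -[X in _ + X](Rintegral_probability_cst (path_prob k w)).
rewrite -(RintegralD measurableT ih ic) /Rintegral fineK//.
exact: integrable_fin_num (integrableD measurableT ih ic).
Qed.

Let shift_ge0 w : (0 <= (h w + C)%:E)%E.
Proof. by rewrite lee_fin; have := hC w; rewrite ler_norml => /andP[]; lra. Qed.

Let mshift : measurable_fun setT (fun w => (h w + C)%:E).
Proof. by apply/measurable_EFinP; exact: measurable_funD. Qed.

Lemma measurable_path_integral k :
  measurable_fun setT (fun w : Om => \int[path_prob k w]_w' h w').
Proof.
rewrite [X in measurable_fun _ X](_ : _ =
    (fun w => fine (\int[Kern k w]_w' (h w' + C)%:E)%E - C)); last first.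
  by apply/funext => w; rewrite -shiftE; exact/esym/addrK.
apply: measurable_funB => //.
apply: (measurableT_comp (f := fine)) => //.
apply: measurable_fun_integral_kernel => // U mU.
exact: measurable_kernel.
Qed.

Lemma path_tower k w : \int[path_prob k.+1 w]_w' h w' =
  \int[PD]_d \int[path_prob k (step (T - k.+1) (w, d))]_w' h w'.
Proof.
have mstp : measurable_fun setT (fun d : borel W => step (T - k.+1) (w, d)).
  exact: (measurableT_comp (measurable_step (stage_lt k)) (pair1_measurable _)).
set V := fun d : borel W => \int[path_prob k (step (T - k.+1) (w, d))]_w' h w'.
have mV : measurable_fun setT V.
  exact: (measurableT_comp (measurable_path_integral k) mstp).
have iV : PD.-integrable setT (EFin \o V).
  apply: (@bounded_measurable_integrable _ _ _ PD V C mV) => d.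
  exact: path_integral_bounded.
have ic : PD.-integrable setT (EFin \o (cst C)).
  exact: finite_measure_integrable_cst.
(* Add [C] to both sides, condition on the first disturbance, and split [C] off again inside. *)
apply: (@addIr _ C); apply: EFin_inj; rewrite shiftE Kern_tower//.
under eq_integral do rewrite -shiftE.
rewrite -[X in _ + X](Rintegral_probability_cst PD).
rewrite -(RintegralD measurableT iV ic) /Rintegral fineK//.
exact: integrable_fin_num (integrableD measurableT iV ic).
Qed.

End bounded_tower.
End path_measure.

(** * Value functions and near-optimal selectors *)

Lemma usc_add (X : topologicalType) (R : realType) (g1 g2 : X -> R) :
  usc g1 -> usc g2 -> usc (fun x => g1 x + g2 x).
Proof.
move=> u1 u2 x a xa.
pose e := (a - (g1 x + g2 x)) / 2.
have e0 : 0 < e by rewrite divr_gt0// subr_gt0.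
have ltDe r : r < r + e by rewrite ltrDl.
have [V1 xV1 V1a] := u1 x _ (ltDe (g1 x)).
have [V2 xV2 V2a] := u2 x _ (ltDe (g2 x)).
exists (V1 `&` V2) => [|y [/V1a h1 /V2a h2]]; first exact: filterI.
by have : e + e = a - (g1 x + g2 x) by [rewrite -splitr|]; lra.
Qed.

Lemma fin_num_norm_le (R : realType) (x : \bar R) (C : R) :
  (`|x| <= C%:E)%E -> x \is a fin_num.
Proof. by case: x. Qed.

Lemma fine_norm_le (R : realType) (x : \bar R) (C : R) :
  (`|x| <= C%:E)%E -> `|fine x| <= C.
Proof. by case: x => [r| |] //=; rewrite lee_fin. Qed.

Section infimum_over_actions.
Context (R : realType) (S A : ptopologicalType).
Variables (US : nat -> set S) (UA : nat -> set A).
Hypotheses (bS : is_base US) (bA : is_base UA).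
Variables (v : S * A -> R) (C : R).
Hypotheses (vC : forall p, `|v p| <= C) (uv : usc v).

Let infv (x : S) : \bar R := ereal_inf (range (fun u => (v (x, u))%:E)).

Lemma inf_bounded x : (`|infv x| <= C%:E)%E.
Proof.
rewrite lee_norm_fin; apply/andP; split.
  apply: le_ereal_inf_tmp => _ [u _ <-]; rewrite lee_fin.
  by have := vC (x, u); rewrite ler_norml => /andP[].
apply: ge_ereal_inf; exists (v (x, point))%:E; first by exists point.
by rewrite lee_fin (le_trans (ler_norm _)).
Qed.

Let infvE x : infv x = (fine (infv x))%:E.
Proof. by rewrite fineK// (fin_num_norm_le (inf_bounded x)). Qed.

Let inf_le x u : fine (infv x) <= v (x, u).
Proof. by rewrite -lee_fin -infvE; apply: ereal_inf_lbound; exists u. Qed.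

Let inf_lt x a : fine (infv x) < a -> exists u, v (x, u) < a.
Proof.
rewrite -lte_fin -infvE => /ereal_inf_lt[_ [u _ <-]].
by rewrite lte_fin; exists u.
Qed.

(** An action that beats [a] at [x] still beats it at nearby states and bounds the infimum there. *)
Lemma inf_usc : usc (fun x => fine (infv x)).
Proof.
move=> x a /inf_lt[u vxu].
have [V [[V1 V2] /= [xV1 uV2] V12] Va] := uv vxu.
exists V1 => // y V1y; apply: le_lt_trans (inf_le y u) _; apply: Va.
by apply: (V12 (y, u)); split => //; exact: nbhs_singleton uV2.
Qed.

(** Follow a dense sequence of actions and take the first one that is optimal up to [eps]. *)
Lemma measurable_selector eps : 0 < eps -> exists g : S -> A,
  measurable_fun setT (g : borel S -> borel A) /\
  forall x, v (x, g x) <= fine (infv x) + eps.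
Proof.
move=> eps0; have [a ad] := is_base_dense bA.
pose E n : set (borel S) := [set x | v (x, a n) < fine (infv x) + eps].
have mE n : measurable (E n).
  rewrite -[X in measurable X]setTI.
  have mv : measurable_fun setT (fun x : borel S => v (x, a n)).
    exact: (@measurable_fun_pair1 _ _ _ (borel S) (borel A) _ v (a n)
      (usc_measurable_prod bS bA uv)).
  have mi : measurable_fun setT (fun x : borel S => fine (infv x) + eps).
    by apply: measurable_funD => //; exact: usc_measurable inf_usc.
  have := measurable_fun_ltr mv mi.
  by move=> /(_ measurableT [set true]); apply.
have exE x : exists n, `[< E n x >].
  (* By semicontinuity, all actions near a good one are good, so the dense sequence meets them. *)
  have [u vxu] : exists u, v (x, u) < fine (infv x) + eps.
    by apply: inf_lt; rewrite ltrDl.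
  have [V [[V1 V2] /= [xV1 uV2] V12] Va] := uv vxu.
  have [n V2n] := ad _ _ uV2.
  exists n; apply/asboolP; apply: Va; apply: (V12 (x, a n)); split => //=.
  exact: nbhs_singleton xV1.
pose N x := ex_minn (exE x).
have NE x : E (N x) x by rewrite /N; case: ex_minnP => n /asboolP.
(* The states with first good index [n] form [E n] minus the earlier [E m], a measurable cell. *)
have NseqDU n : [set x | N x = n] = seqDU E n.
  apply/seteqP; split=> [x <-|x [Enx nEx]].
    split=> //; rewrite -bigcup_mkord => -[m /= mN Emx].
    move: mN; rewrite /N; case: ex_minnP => k _ /(_ m).
    by move=> /(_ (asboolT Emx)); rewrite leqNgt => /negbTE ->.
  rewrite /N /=; case: ex_minnP => k /asboolP Ekx /(_ n (asboolT Enx)).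
  rewrite leq_eqVlt => /predU1P[//|kn]; exfalso; apply: nEx.
  by rewrite -bigcup_mkord; exists k.
exists (fun x => a (N x)); split=> [_ B mB|x]; last exact/ltW/NE.
rewrite setTI (_ : _ @^-1` B = \bigcup_(n in [set n | B (a n)]) seqDU E n).
  apply: bigcup_measurable => n _; apply: measurableD => //.
  by apply: bigsetU_measurable => i _.
apply/seteqP; split=> [x Bx|x [n /= Bn]].
  by exists (N x) => //; rewrite -NseqDU.
by rewrite -NseqDU /preimage /= => ->.
Qed.

End infimum_over_actions.

Section value_functions.
Context (R : realType) (T : nat) (S A W : ptopologicalType).
Variables (f : S -> A -> W -> S) (PD : probability (borel W) R) (alpha : R).
Hypothesis mf : measurable_fun [set: (borel S * borel A * borel W)%type]
  (fun p : (borel S * borel A * borel W)%type =>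
    (f p.1.1 p.1.2 p.2 : borel S)).
Hypothesis halpha : 0 < alpha <= 1.
Variables (US : nat -> set S) (UA : nat -> set A).
Hypotheses (bS : is_base US) (bA : is_base UA).
Hypothesis hQ : forall (s : nat -> (S * A)%type) (p : (S * A)%type),
  s @ \oo --> p ->
  (fun n => tv_dist (Qk f PD (s n).1 (s n).2) (Qk f PD p.1 p.2)) @ \oo --> 0%E.

Section risk_usc.
Variables (j : S -> R) (C : R).
Hypotheses (mj : measurable_fun setT (j : borel S -> R))
  (C0 : 0 < C) (jC : forall y, `|j y| <= C).

Let phi x u := phi_op T f PD alpha (EFin \o j) x u.

Let phiE x u : phi x u = (fine (phi x u))%:E.
Proof.
by rewrite fineK// (fin_num_norm_le (phi_op_bounded T PD mf halpha mj jC x u)).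
Qed.

(** Along a sequence converging to [p] the transition laws become close in total variation, and
    [phi_op_close] then bounds the increase of the risk. *)
Lemma phi_op_usc : usc (fun p : S * A => fine (phi p.1 p.2)).
Proof.
move=> p a pa.
exists [set q : S * A | fine (phi q.1 q.2) < a] => //.
have [U bU] : exists U : nat -> set (S * A)%type, is_base U.
  by have [oU cU] := is_base_prod bS bA; exact: is_base_countType oU cU.
apply: (nbhs_seqP bU) => s sp.
pose K : R := 4 * C * powR alpha (- (T%:R^-1)).
have K0 : 0 < K.
  by rewrite !mulr_gt0// (lt_le_trans ltr01 (level_ge1 T halpha)).
(* With [K] the constant of [phi_op_close], the increase [K * dlt] uses half of the gap below [a],
   so the inequality stays strict. *)
pose dlt := (a - fine (phi p.1 p.2)) / 2 / K.
have dlt0 : 0 < dlt by rewrite !divr_gt0// subr_gt0.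
have : \forall n \near \oo, (tv_dist (Qk f PD (s n).1 (s n).2)
    (Qk f PD p.1 p.2) < dlt%:E)%E.
  have := hQ sp; move=> /(_ [set r | (r < dlt%:E)%E]); apply.
  by apply: open_ereal_lt'; rewrite lte_fin.
move=> [n _ /(_ n (leqnn n)) /= tvn]; exists n.
have close (E : set (borel S)) : measurable E ->
    `|fine (Qp PD mf (s n).1 (s n).2 E) - fine (Qp PD mf p.1 p.2 E)| <= dlt.
  by move=> mE; apply: tv_dist_setwise mE.
have := phi_op_close T halpha mj C0 jC close.
rewrite -/(phi _ _) -/(phi p.1 p.2) (phiE (s n).1) (phiE p.1) -EFinD lee_fin -/K.
rewrite [K * _]mulrC /dlt divfK ?gt_eqF//; lra.
Qed.

End risk_usc.

Variables (c : nat -> S -> A -> R) (cT : S -> R).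
Hypothesis hc : forall t, (t < T)%N ->
  bounded_rfun (fun p : (S * A)%type => c t p.1 p.2) /\
  usc (fun p : (S * A)%type => c t p.1 p.2).
Hypothesis hcT : bounded_rfun cT /\ usc cT.

Let Jr k (x : S) : R := fine (Jrec T f PD alpha c cT k x).

(** This is [v_t] at [t = T - k.+1], made real-valued for the lemmas on semicontinuity and
    selection; [k] counts the stages after [t]. *)
Definition action_value k (p : S * A) : R :=
  c (T - k.+1) p.1 p.2 +
  fine (phi_op T f PD alpha (Jrec T f PD alpha c cT k) p.1 p.2).

(** Invariant of the backward recursion. The bound is strictly positive because [phi_op_usc] divides
    by a multiple of it. *)
Definition regular_value (g : S -> \bar R) : Prop :=
  exists C : R, [/\ 0 < C, forall x, (`|g x| <= C%:E)%E &
    usc (fun x => fine (g x))].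

Lemma action_value_regular k : (k < T)%N ->
  regular_value (Jrec T f PD alpha c cT k) ->
  (exists2 C, 0 < C & forall p, `|action_value k p| <= C) /\
  usc (action_value k) /\
  (forall x, Jrec T f PD alpha c cT k.+1 x =
    ereal_inf (range (fun u => (action_value k (x, u))%:E))).
Proof.
move=> kT [C [C0 JC uJ]].
have JE : Jrec T f PD alpha c cT k = EFin \o Jr k.
  by apply/funext => x; rewrite /= fineK// (fin_num_norm_le (JC x)).
have mJ : measurable_fun setT (Jr k : borel S -> R) by exact: usc_measurable.
have JrC x : `|Jr k x| <= C by exact: fine_norm_le (JC x).
have [[B cB] uc] : bounded_rfun (fun p : (S * A)%type => c (T - k.+1) p.1 p.2) /\
    usc (fun p : (S * A)%type => c (T - k.+1) p.1 p.2).
  by apply: hc; rewrite ltn_subrL (leq_ltn_trans _ kT).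
have phiC x u := phi_op_bounded T PD mf halpha mJ JrC x u.
split; [|split].
- exists (B + C) => [|p].
    by rewrite ltr_wpDl// (le_trans _ (cB point)).
  rewrite /action_value JE (le_trans (ler_normD _ _))//.
  apply: lerD; first exact: (cB p).
  exact: fine_norm_le (phiC _ _).
- apply: usc_add => //; rewrite JE; exact: (phi_op_usc mJ C0 JrC).
- move=> x; rewrite [LHS]/=; congr ereal_inf; congr (_ @` _).
  apply/funext => u; rewrite /action_value EFinD JE fineK//.
  exact: fin_num_norm_le (phiC _ _).
Qed.

Lemma Jrec_regular k : (k <= T)%N -> regular_value (Jrec T f PD alpha c cT k).
Proof.
elim: k => [_|k IHk kT].
  have [[B cB] uc] := hcT; exists (B + 1); split=> // [|x].
    by rewrite ltr_wpDl// (le_trans _ (cB point)).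
  by rewrite /= lee_fin (le_trans (cB x))// lerDl.
have [[C C0 vC] [uv JE]] := action_value_regular kT (IHk (ltnW kT)).
exists C; split=> // [x|].
  by rewrite JE; exact: inf_bounded.
under eq_fun do rewrite JE.
exact: inf_usc vC uv.
Qed.

End value_functions.

(** * Policy evaluation *)

Section policy_evaluation.
Context (R : realType) (T : nat) (S A W : ptopologicalType).
Variables (f : S -> A -> W -> S) (PD : probability (borel W) R) (alpha : R).
Hypothesis mf : measurable_fun [set: (borel S * borel A * borel W)%type]
  (fun p : (borel S * borel A * borel W)%type =>
    (f p.1.1 p.1.2 p.2 : borel S)).
Hypothesis halpha : 0 < alpha <= 1.
Hypothesis hT : (0 < T)%N.
Variable g : nat -> S -> A.
Hypothesis mg : forall t, (t < T)%N ->
  measurable_fun setT (fun x : borel S => (g t x : borel A)).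
Variable xi : nat -> S -> S -> A -> R.
Hypothesis hxi : Dalpha T f PD alpha xi.
Local Notation Om := (Omega T S A).

Let M : R := powR alpha (- (T%:R^-1)).

Definition weight t (w : traj S A) : R := xi t (w.1 t.+1) (w.1 t) (w.2 t).

Definition cweight t (w : traj S A) : R := Num.max 0 (Num.min M (weight t w)).

Lemma measurable_weight t : (t < T)%N ->
  measurable_fun setT (weight t : Om -> R).
Proof.
move=> tT; have [mxi _] := hxi tT.
exact: (measurableT_comp mxi (measurable_fun_pair (measurable_fun_pair
  (@measurable_state T S A t.+1 tT) (@measurable_state T S A t (ltnW tT)))
  (@measurable_action T S A t tT))).
Qed.

Lemma measurable_cweight t : (t < T)%N ->
  measurable_fun setT (cweight t : Om -> R).
Proof. by move=> tT; exact: (measurable_clamp T alpha (measurable_weight tT)). Qed.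

Lemma cweight_itv t w : 0 <= cweight t w <= M.
Proof. exact: (clamp_itv T halpha (fun=> weight t w) point). Qed.

Let bad : set Om :=
  \bigcup_(s in [set s | (s < T)%N]) (weight s : Om -> R) @^-1` (~` `[0, M]).

Let mbad : measurable bad.
Proof.
apply: bigcup_measurable => s /= sT.
rewrite -[X in measurable X]setTI; apply: measurable_weight => //.
exact: measurableC.
Qed.

Let goodE s w : (s < T)%N -> ~ bad w -> 0 <= weight s w <= M.
Proof.
by move=> sT nbad; apply: contrapT => h; apply: nbad; exists s => //=.
Qed.

(* If no weight has left [0, M] so far, almost surely none will. *)
Let Kern_bad k (w : Om) : (k <= T)%N ->
  (forall s, (s < T - k)%N -> 0 <= weight s w <= M) ->
  Kern PD mf hT mg k w bad = 0%E.
Proof.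
elim: k w => [|k IHk] w kT good.
  rewrite /= /kdirac /= /dirac indicE memNset// => -[s /= sT]; apply => /=.
  by rewrite in_itv/= good// subn0.
have tk : (T - k = (T - k.+1).+1)%N by rewrite subnSK.
set t := (T - k.+1)%N in tk good *; have tT : (t < T)%N := stage_lt hT k.
set x := w.1 t; set u := g t x.
have [_ [N [mN QN] xiN] _] := (hxi tT).2 x u.
transitivity (\int[PD]_d Kern PD mf hT mg k (step f g t (w, d)) bad)%E => //.
rewrite -[RHS](integral0 PD setT); apply: ae_eq_integral => //.
  have mstp : measurable_fun setT (fun d : borel W => step f g t (w, d) : Om).
    exact: (measurableT_comp (measurable_step mf mg tT) (pair1_measurable _)).
  exact: (measurableT_comp
    (measurable_kernel (Kern PD mf hT mg k) bad mbad) mstp).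
(* The disturbances that lead into the null set [N] on which [xi t] may leave [[0, M]]. *)
exists (f x u @^-1` N); split => [||d /= hd].
- by rewrite -[X in measurable X]setTI; exact: measurable_transition.
- exact: QN.
apply: xiN => /= hxu; apply: hd => _; apply: IHk => [|s]; first exact: ltnW.
(* The weight of stage [t] is the new one; earlier weights read only coordinates that the step
   leaves alone. *)
rewrite tk ltnS leq_eqVlt => /predU1P[->|st].
  by rewrite /weight /step /upd /= !eqxx ltn_eqF.
rewrite /weight /step /upd /= eqSS !ltn_eqF// ?(leqW st)//.
exact: good.
Qed.

Variable Y : traj S A -> R.
Variable CY : R.
Hypotheses (mY : measurable_fun setT (Y : Om -> R))
  (YC : forall w, `|Y w| <= CY).

(** Clamped weights make the payoff bounded at every trajectory, as the tower property requires. *)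
Definition cpayoff (w : traj S A) : R := Y w * \prod_(t < T) cweight t w.

Lemma measurable_cpayoff : measurable_fun setT (cpayoff : Om -> R).
Proof.
apply: measurable_funM => //.
by apply: measurable_prod => i _; exact: measurable_cweight.
Qed.

Lemma cpayoff_bounded w : `|cpayoff w| <= CY * M ^+ T.
Proof.
rewrite normrM ler_pM// normr_prod.
rewrite -[X in _ ^+ X](card_ord T) -prodr_const.
apply: ler_prod => i _; rewrite normr_ge0/=.
by have /andP[w0 wM] := cweight_itv i w; rewrite ger0_norm.
Qed.

(** The two payoffs differ only on [bad], which is null by [Kern_bad] at [k = T], where there is no
    earlier weight to check. *)
Lemma payoff_integral x :
  (\int[@Defs.pathP R T S A W f PD x (markov_policy R g)]_(w in [set: Om])
     (Y w * \prod_(t < T) xi t (w.1 t.+1) (w.1 t) (w.2 t))%:E =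
   (\int[path_prob PD mf hT mg T (init_traj A x)]_w cpayoff w)%:E)%E.
Proof.
rewrite (pathP_integral PD mf hT mg) /Rintegral fineK; last first.
  apply: integrable_fin_num => //.
  exact: bounded_measurable_integrable measurable_cpayoff cpayoff_bounded.
apply: ae_eq_integral => //.
- apply/measurable_EFinP; apply: measurable_funM => //.
  by apply: measurable_prod => i _; exact: measurable_weight.
- by apply/measurable_EFinP; exact: measurable_cpayoff.
exists bad; split=> //; first by apply: Kern_bad => // s; rewrite subnn.
move=> w /= hw; apply: contrapT => nbad; apply: hw => _.
congr (_ * _)%:E; apply: eq_bigr => t _.
rewrite -[LHS]/(weight t w) /cweight.
by have /andP[w0 wM] := goodE (ltn_ord t) nbad; rewrite min_r// max_r.
Qed.

End policy_evaluation.

(** * Backward induction for a fixed policy and fixed densities *)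

Section backward_induction.
Context (R : realType) (T : nat) (S A W : ptopologicalType).
Variables (f : S -> A -> W -> S) (PD : probability (borel W) R) (alpha : R).
Hypothesis mf : measurable_fun [set: (borel S * borel A * borel W)%type]
  (fun p : (borel S * borel A * borel W)%type =>
    (f p.1.1 p.1.2 p.2 : borel S)).
Hypothesis halpha : 0 < alpha <= 1.
Hypothesis hT : (0 < T)%N.
Variable g : nat -> S -> A.
Hypothesis mg : forall t, (t < T)%N ->
  measurable_fun setT (fun x : borel S => (g t x : borel A)).
Variable xi : nat -> S -> S -> A -> R.
Hypothesis hxi : Dalpha T f PD alpha xi.
Variables (c : nat -> S -> A -> R) (cT : S -> R) (eps : R).
Local Notation Om := (Omega T S A).
Local Notation cw := (cweight T alpha xi).
Let Jn := Jrec T f PD alpha c cT.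
Let Y := total_cost T c cT.
Variables CY : R.
Hypotheses (mY : measurable_fun setT (Y : Om -> R))
  (YC : forall w, `|Y w| <= CY).
Hypothesis regJ : forall k, (k <= T)%N -> regular_value (Jn k).
Hypothesis hg : forall k x, (k < T)%N ->
  action_value T f PD alpha c cT k (x, g (T - k.+1) x) <=
  fine (Jn k.+1 x) + eps.

Let past_weight t (w : traj S A) : R := \prod_(s < t) cw s w.
Let past_cost t (w : traj S A) : R := \sum_(s < t) c s (w.1 s) (w.2 s).

Let past_weight_step t (w : Om) d : past_weight t.+1 (step f g t (w, d)) =
  past_weight t w *
  clamp T alpha (fun y => xi t y (w.1 t) (g t (w.1 t)))
    (f (w.1 t) (g t (w.1 t)) d).
Proof.
rewrite /past_weight big_ord_recr/=; congr (_ * _).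
  apply: eq_bigr => s _; rewrite /cweight /weight /step /upd /= eqSS.
  by rewrite (ltn_eqF (ltn_ord s)) (ltn_eqF (leqW (ltn_ord s))).
by rewrite /cweight /weight /step /upd /= !eqxx ltn_eqF.
Qed.

Let past_cost_step t (w : Om) d : past_cost t.+1 (step f g t (w, d)) =
  past_cost t w + c t (w.1 t) (g t (w.1 t)).
Proof.
rewrite /past_cost big_ord_recr/=; congr (_ + _).
  apply: eq_bigr => s _; rewrite /step /upd /=.
  by rewrite (ltn_eqF (ltn_ord s)) (ltn_eqF (leqW (ltn_ord s))).
by rewrite /step /upd /= eqxx ltn_eqF.
Qed.

Let past_weight_ge0 t w : 0 <= past_weight t w.
Proof.
by apply: prodr_ge0 => s _; have /andP[] := cweight_itv T W halpha xi s w.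
Qed.

Let h := cpayoff T alpha xi Y.
Let mh : measurable_fun setT (h : Om -> R).
Proof. exact: (measurable_cpayoff hxi mY). Qed.
Let hC (w : Om) := cpayoff_bounded T W halpha xi YC w.

Section one_step.
Variables (k : nat) (x : S) (a b : R).
Hypotheses (kT : (k < T)%N) (a0 : 0 <= a).
Let t := (T - k.+1)%N.
Let u := g t x.
Let nu := clamp T alpha (fun y => xi t y x u).
Let j y := fine (Jn k y).

Let rnu : Ralpha T f PD alpha x u (fun y => xi t y x u).
Proof. exact: (hxi (stage_lt hT k)).2. Qed.

Let dnu : is_density (Qp PD mf x u) (powR alpha (- (T%:R^-1))) nu.
Proof. exact: clamp_density. Qed.

Let mj : measurable_fun setT (j : borel S -> R).
Proof. by have [C [_ _ uJ]] := regJ (ltnW kT); exact: usc_measurable. Qed.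

Let jC : exists C, forall y, `|j y| <= C.
Proof.
have [C [_ JC _]] := regJ (ltnW kT).
by exists C => y; exact: fine_norm_le (JC y).
Qed.

Let JE : Jn k = EFin \o j.
Proof.
have [C [_ JC _]] := regJ (ltnW kT).
by apply/funext => y; rewrite /= fineK// (fin_num_norm_le (JC y)).
Qed.

Let mF : measurable_fun setT (fun y : borel S => a * nu y * (b + j y)).
Proof.
have [mnu _ _] := dnu.
by apply: measurable_funM; [exact: measurable_funM | exact: measurable_funD].
Qed.

Lemma one_step_integrable : PD.-integrable setT
  (EFin \o (fun d => a * nu (f x u d) * (b + j (f x u d)))).
Proof.
have [C jbound] := jC; have [_ nuM _] := dnu.
apply: (@bounded_measurable_integrable _ _ _ PD _
    (a * powR alpha (- (T%:R^-1)) * (`|b| + C))) => [|d].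
  exact: (measurableT_comp mF (measurable_transition mf x u)).
have /andP[nu0 nuM'] := nuM (f x u d).
rewrite normrM ler_pM//.
  by rewrite ger0_norm ?mulr_ge0// ler_wpM2l.
by rewrite (le_trans (ler_normD _ _))// lerD2l.
Qed.

(** Factor out [a >= 0]. As [nu] has mass 1, [b] comes out unchanged; the integral of [j] against
    [nu] is at most the risk operator, and adding [c t x u] gives an action value, which [hg]
    bounds. *)
Lemma one_step_bound :
  \int[PD]_d (a * nu (f x u d) * (b + j (f x u d))) <=
  a * (b - c t x u + fine (Jn k.+1 x) + eps).
Proof.
have [C jbound] := jC; have [mnu nuM int1] := dnu.
have inu := is_density_integrable (Qp PD mf x u) dnu.
have ijnu := integrableM_density (Qp PD mf x u) dnu mj jbound.
have phi_fin : phi_op T f PD alpha (Jn k) x u \is a fin_num.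
  by rewrite JE (fin_num_norm_le (phi_op_bounded T PD mf halpha mj jbound x u)).
have iB : (Qp PD mf x u).-integrable setT
    (EFin \o (fun y => b * nu y + j y * nu y)).
  exact: (integrableD measurableT (integrableZl measurableT b inu) ijnu).
have -> : \int[PD]_d (a * nu (f x u d) * (b + j (f x u d))) =
    \int[Qp PD mf x u]_y (a * (b * nu y + j y * nu y)).
  transitivity (\int[Qp PD mf x u]_y (a * nu y * (b + j y))).
    rewrite /Rintegral [in RHS](integral_pushforward (measurable_transition mf x u)
      (f := fun y => (a * nu y * (b + j y))%:E))//.
      by apply/measurable_EFinP; exact: mF.
    exact: one_step_integrable.
  by apply: eq_Rintegral => y _; ring.
rewrite (RintegralZl _ measurableT iB) ler_wpM2l//.
rewrite (RintegralD measurableT (integrableZl measurableT b inu) ijnu).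
rewrite (RintegralZl _ measurableT inu) int1 mulr1 -!addrA lerD2l.
rewrite -lerBlDl opprK [leLHS]addrC.
apply: le_trans (hg x kT); rewrite /action_value /= lerD2l.
rewrite -lee_fin [leRHS]fineK//; apply: ereal_sup_ubound.
exists (fun y => xi t y x u) => //.
rewrite -/Jn JE; apply: etrans (clamp_integral mf rnu mj) _.
rewrite /Rintegral fineK//.
exact: integrable_fin_num ijnu.
Qed.

End one_step.

(** Induction on the number [k] of stages left: [path_tower] conditions on the next disturbance, the
    induction hypothesis bounds the integrand, and [one_step_bound] integrates it. *)
Lemma path_value_bound k (w : Om) : (k <= T)%N ->
  \int[path_prob PD mf hT mg k w]_w' h w' <=
  past_weight (T - k) w *
  (past_cost (T - k) w + fine (Jn k (w.1 (T - k)%N)) + k%:R * eps).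
Proof.
elim: k w => [|k IHk] w kT.
  rewrite path_prob0// subn0 /h /cpayoff /Y /total_cost mul0r addr0.
  by rewrite mulrC [cT _ + _]addrC.
rewrite (path_tower PD mf hT mg mh hC).
set t := (T - k.+1)%N; set x := w.1 t; set u := g t x.
have tk : (T - k = t.+1)%N by rewrite /t subnSK.
have tT : (t < T)%N := stage_lt hT k.
(* Cost up to and including stage [t], plus the errors of the [k] later stages; the final [eps]
   below is the error of stage [t] itself. *)
pose b := past_cost t w + c t x u + k%:R * eps.
apply: le_trans (_ : _ <= past_weight t w *
  (b - c t x u + fine (Jn k.+1 x) + eps)) _; last first.
  by rewrite ler_wpM2l// /b -natr1 mulrDl mul1r; lra.
apply: le_trans (one_step_bound x b kT (past_weight_ge0 t w)).
have mstp : measurable_fun setT (fun d : borel W => step f g t (w, d) : Om).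
  exact: (measurableT_comp (measurable_step mf mg tT) (pair1_measurable _)).
apply: le_Rintegral => //.
- apply: (bounded_measurable_integrable PD).
    exact: (measurableT_comp (measurable_path_integral PD mf hT mg mh hC k) mstp).
  by move=> d; exact: (path_integral_bounded PD mf hT mg mh hC).
- exact: one_step_integrable.
move=> d _; apply: le_trans (IHk _ (ltnW kT)) _.
rewrite tk past_weight_step past_cost_step -/x -/u.
rewrite le_eqVlt; apply/orP; left; apply/eqP; congr (_ * _).
rewrite /step /upd /= eqxx -/x -/u /b; ring.
Qed.

End backward_induction.

(** * The total cost and near-optimal Markov policies *)

Section total_cost.
Context (R : realType) (T : nat) (S A : ptopologicalType).
Variables (c : nat -> S -> A -> R) (cT : S -> R).
Hypothesis hc : forall t, (t < T)%N ->
  bounded_rfun (fun p : (S * A)%type => c t p.1 p.2) /\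
  usc (fun p : (S * A)%type => c t p.1 p.2).
Hypothesis hcT : bounded_rfun cT /\ usc cT.

Lemma total_cost_bounded : bounded_rfun (total_cost T c cT).
Proof.
have [[B cB] _] := hcT.
have /choice[D cD] (t : 'I_T) : exists D, forall x u, `|c t x u| <= D.
  by have [[D cD] _] := hc (ltn_ord t); exists D => x u; exact: (cD (x, u)).
exists (B + \sum_(t < T) D t) => w; rewrite /total_cost.
rewrite (le_trans (ler_normD _ _))// lerD//.
by rewrite (le_trans (ler_norm_sum _ _ _))// ler_sum.
Qed.

Lemma measurable_total_cost (US : nat -> set S) (UA : nat -> set A) :
  is_base US -> is_base UA ->
  measurable_fun setT (total_cost T c cT : Omega T S A -> R).
Proof.
move=> bS bA; apply: measurable_funD.
  exact: (measurableT_comp (usc_measurable hcT.2)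
    (@measurable_state T S A T (leqnn T))).
apply: measurable_sum => t; have [_ uc] := hc (ltn_ord t).
exact: (measurableT_comp (usc_measurable_prod bS bA uc) (measurable_fun_pair
  (@measurable_state T S A t (ltnW (ltn_ord t)))
  (@measurable_action T S A t (ltn_ord t)))).
Qed.

End total_cost.

(** The Dirac mass gives [B] the indicator of [B] at the chosen action, a measurable function of the
    current state alone. *)
Lemma markov_policyP (R : realType) (T : nat) (S A : ptopologicalType)
    (g : nat -> S -> A) :
  (forall t, (t < T)%N ->
    measurable_fun setT (fun x : borel S => (g t x : borel A))) ->
  is_policy T (markov_policy R g).
Proof.
move=> mg t tT; split=> [B mB|w w' ww' _]; last first.
  by rewrite /markov_policy ww'.
have mI : measurable_fun setT (\1_B : borel A -> R) by exact: measurable_indic.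
have mgt := measurableT_comp (mg t tT) (@measurable_state T S A t (ltnW tT)).
rewrite [X in measurable_fun _ X](_ : _ =
  fun w : Omega T S A => (\1_B (g t (w.1 t)) : R)%:E)//.
by apply/measurable_EFinP; exact: (measurableT_comp mI mgt).
Qed.

(** [path_value_bound] at [k = T]: past weight and past cost are an empty product and an empty sum,
    and the bound is uniform in [xi]. *)
Lemma rho_markov_le (R : realType) (T : nat) (S A W : ptopologicalType)
    (f : S -> A -> W -> S) (PD : probability (borel W) R) (alpha : R)
    (g : nat -> S -> A) (c : nat -> S -> A -> R) (cT : S -> R) (CY eps : R) :
  measurable_fun [set: (borel S * borel A * borel W)%type]
    (fun p : (borel S * borel A * borel W)%type =>
      (f p.1.1 p.1.2 p.2 : borel S)) ->
  0 < alpha <= 1 -> (0 < T)%N ->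
  (forall t, (t < T)%N ->
    measurable_fun setT (fun x : borel S => (g t x : borel A))) ->
  measurable_fun setT (total_cost T c cT : Omega T S A -> R) ->
  (forall w, `|total_cost T c cT w| <= CY) ->
  (forall k, (k <= T)%N -> regular_value (Jrec T f PD alpha c cT k)) ->
  (forall k x, (k < T)%N ->
    action_value T f PD alpha c cT k (x, g (T - k.+1)%N x) <=
    fine (Jrec T f PD alpha c cT k.+1 x) + eps) ->
  forall x, (rho T f PD alpha (markov_policy R g) x (total_cost T c cT) <=
    J T f PD alpha c cT 0 x + (T%:R * eps)%:E)%E.
Proof.
move=> mf halpha hT mg mY YC regJ hg x; apply: ge_ereal_sup => _ [xi hxi <-].
have [C [_ JC _]] := regJ T (leqnn T).
have JE : J T f PD alpha c cT 0 x = (fine (Jrec T f PD alpha c cT T x))%:E.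
  by rewrite /J subn0 fineK// (fin_num_norm_le (JC x)).
rewrite (payoff_integral mf halpha hT mg hxi mY YC) JE -EFinD lee_fin.
have := path_value_bound mf halpha hT mg hxi mY YC regJ hg
  (init_traj A x) (leqnn T).
by rewrite subnn !big_ord0 mul1r add0r.
Qed.

Theorem theorem3 (R : realType) (T : nat) (S A W : ptopologicalType)
  (hS : borel_space R S) (hA : borel_space R A) (hW : borel_space R W)
  (f : S -> A -> W -> S)
  (mf : measurable_fun [set: (borel S * borel A * borel W)%type]
          (fun p : (borel S * borel A * borel W)%type =>
             (f p.1.1 p.1.2 p.2 : borel S)))
  (PD : probability (borel W) R)
  (c : nat -> S -> A -> R) (cT : S -> R)
  (hc : forall t, (t < T)%N ->
     bounded_rfun (fun p : (S * A)%type => c t p.1 p.2) /\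
     usc (fun p : (S * A)%type => c t p.1 p.2))
  (hcT : bounded_rfun cT /\ usc cT)
  (hQ : forall (s : nat -> (S * A)%type) (p : (S * A)%type),
     s @ \oo --> p ->
     (fun n => tv_dist (Qk f PD (s n).1 (s n).2) (Qk f PD p.1 p.2)) @ \oo
       --> 0%E)
  (alpha : R) (halpha : 0 < alpha <= 1) (hT : (0 < T)%N) :
  (forall t, (t <= T)%N ->
     bounded_efun (J T f PD alpha c cT t) /\ usc_e (J T f PD alpha c cT t))
  /\
  (forall eps : R, 0 < eps ->
     exists g : nat -> S -> A,
       (forall t, (t < T)%N -> measurable_fun [set: borel S]
                                 (fun x : borel S => (g t x : borel A))) /\
       forall x : S,
         (rho T f PD alpha (markov_policy R g) x (total_cost T c cT)
            <= J T f PD alpha c cT 0 x + eps%:E)%E)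
  /\
  (forall x : S,
     (ereal_inf [set rho T f PD alpha pi x (total_cost T c cT)
                | pi in [set pi | is_policy T pi]]
        <= J T f PD alpha c cT 0 x)%E).
Proof.
have [US bS] := borel_space_base hS; have [UA bA] := borel_space_base hA.
have regJ := Jrec_regular mf halpha bS bA hQ hc hcT.
have near_optimal (eps : R) : 0 < eps ->
    exists g : nat -> S -> A,
      (forall t, (t < T)%N -> measurable_fun [set: borel S]
        (fun x : borel S => (g t x : borel A))) /\
      forall x : S,
        (rho T f PD alpha (markov_policy R g) x (total_cost T c cT)
          <= J T f PD alpha c cT 0 x + eps%:E)%E.
  move=> eps0; have T0 : 0 < T%:R :> R by rewrite ltr0n.
  (* Each of the [T] stages may lose [eps / T]. Selectors are indexed by the number [k] of later
     stages; for [k >= T] a constant serves as default. *)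
  have /choice[G GP] k : exists G : S -> A, (k < T)%N ->
      measurable_fun setT (G : borel S -> borel A) /\
      forall x, action_value T f PD alpha c cT k (x, G x) <=
        fine (Jrec T f PD alpha c cT k.+1 x) + eps / T%:R.
    have [kT|_] := ltnP k T; last by exists (fun=> point).
    have [[C _ vC] [uv JE]] :=
      action_value_regular mf halpha bS bA hQ hc kT (regJ _ (ltnW kT)).
    have [G [mG GP]] := measurable_selector bS bA vC uv (divr_gt0 eps0 T0).
    by exists G => _; split=> // x; rewrite JE.
  have [CY YC] := total_cost_bounded hc hcT.
  (* Time [t] is followed by [T - t.+1] stages, and this reindexing is an involution below [T]. *)
  exists (fun t => G (T - t.+1)%N); split=> [t tT|x].
    by apply: (GP _ _).1; exact: stage_lt.
  have -> : eps = T%:R * (eps / T%:R) by rewrite mulrC divfK// lt0r_neq0.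
  apply: (rho_markov_le mf halpha hT _
    (measurable_total_cost hc hcT bS bA) YC regJ) => [t tT|k y kT].
    by apply: (GP _ _).1; exact: stage_lt.
  rewrite subnSK// subKn; last exact: ltnW.
  exact: (GP k kT).2.
split; [|split=> //].
  move=> t tT; have [C [_ JC uJ]] := regJ _ (leq_subr t T).
  split; first by exists C.
  move=> x a; rewrite /J -(fineK (fin_num_norm_le (JC x))) lte_fin => /uJ[V xV Va].
  exists V => // y /Va; rewrite -lte_fin.
  by rewrite (fineK (fin_num_norm_le (JC y))).
(* For every [e > 0] the near-optimal Markov policy competes in the infimum. *)
move=> x; apply/lee_addgt0Pr => e /near_optimal[g [mg rg]].
apply: le_trans (rg x); apply: ereal_inf_lbound.
by exists (markov_policy R g) => //; exact: markov_policyP.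
Qed.
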